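(* For all finite sets $\mathcal X,\mathcal Y,\mathcal Z$, every $f\colon\mathcal X\times\mathcal Y\to\mathcal Z$, every probability measure $\mu$ on $\mathcal X\times\mathcal Y$ and every $\epsilon\in[0,1]$, \[ \mathrm{IC}_\mu(f,\epsilon)\ge \mathrm{IC}_\mu(f,0)-4|\mathcal X||\mathcal Y|\,\hat h(\sqrt{\epsilon}). \]
   Context: Two-party randomized protocols with public and private randomness; transcript $\Pi$ consists of public randomness and exchanged bits; $\pi(x,y)$ is the output. For $(X,Y)\sim\mu$, $\mathrm{IC}_\mu(\pi)=I(\Pi;X\mid Y)+I(\Pi;Y\mid X)$. A protocol performs $[f,\epsilon]$ if $\Pr[\pi(x,y)\ne f(x,y)]\le\epsilon$ for every input; $\mathrm{IC}_\mu(f,\epsilon)$ is the infimum of $\mathrm{IC}_\mu(\pi)$ over protocols performing $[f,\epsilon]$. $h$ is the binary entropy function (base 2) and $\hat h(x)=h(\min(x,1/2))$. *)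

(* Defs.v *)
From HB Require Import structures.
From mathcomp Require Import all_boot all_order all_algebra.
From mathcomp Require Import all_classical all_reals all_analysis.

Set Implicit Arguments.
Unset Strict Implicit.
Unset Printing Implicit Defensive.

Import Order.TTheory GRing.Theory Num.Theory.
Import numFieldNormedType.Exports.

Local Open Scope classical_set_scope.
Local Open Scope ring_scope.

Section Entropy.
Variable R : realType.

Definition log2 (x : R) : R := ln x / ln 2.

Definition binary_entropy (x : R) : R :=
  - (x * log2 x) - (1 - x) * log2 (1 - x).

Definition hhat (x : R) : R := binary_entropy (Num.min x (1 / 2)).

Definition is_pmf (A : finType) (p : A -> R) : Prop :=
  (forall a, 0 <= p a) /\ \sum_a p a = 1.

Definition entropy (A : finType) (p : A -> R) : R :=
  - \sum_a p a * log2 (p a).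

(* H(A | C), the average over c of the entropy of A given C = c.  Values c of
   probability 0 contribute 0. *)
Definition cond_entropy (A C : finType) (p : A * C -> R) : R :=
  \sum_c (\sum_a p (a, c)) * entropy (fun a => p (a, c) / \sum_a' p (a', c)).

(* I(A ; B | C) = H(A | C) - H(A | B, C) *)
Definition cond_mutual_info (A B C : finType) (p : A * B * C -> R) : R :=
  cond_entropy (fun u : A * C => \sum_b p (u.1, b, u.2))
  - cond_entropy (fun u : A * (B * C) => p (u.1, u.2.1, u.2.2)).

End Entropy.

Definition fiber_measurable d (T : measurableType d) (K : Type) (g : T -> K) :=
  forall k, measurable [set t | g t = k].

Inductive party := Alice | Bob.

(* The public and the two private random strings are independent and have
   arbitrary distributions.  After the bits [h] have been exchanged,
   [turn r h] is the party sending the next bit, or [None] when the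
   communication is over; the number of exchanged bits is bounded.  The output
   is a function of the transcript. *)
Record protocol (R : realType) (X Y Z : finType) := Protocol {
  pub_d : measure_display;
  pub : measurableType pub_d;
  pub_law : probability pub R;
  privA_d : measure_display;
  privA : measurableType privA_d;
  privA_law : probability privA R;
  privB_d : measure_display;
  privB : measurableType privB_d;
  privB_law : probability privB R;
  turn : pub -> seq bool -> option party;
  bitA : X -> pub * privA -> seq bool -> bool;
  bitB : Y -> pub * privB -> seq bool -> bool;
  output : pub * seq bool -> Z;
  max_bits : nat;
  turn_measurable : forall h, fiber_measurable (turn ^~ h);
  bitA_measurable : forall x h, fiber_measurable (bitA x ^~ h);
  bitB_measurable : forall y h, fiber_measurable (bitB y ^~ h);
  output_measurable : forall h, fiber_measurable (fun r => output (r, h));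
  turn_bounded : forall r h, (max_bits <= size h)%N -> turn r h = None
}.

Section InformationComplexity.
Variables (R : realType) (X Y Z : finType).
Implicit Types (pi : protocol R X Y Z) (mu : X * Y -> R).

Definition randomness pi : Type := (pub pi * privA pi * privB pi)%type.

Definition randomness_law pi : set (randomness pi) -> \bar R :=
  (pub_law pi \x privA_law pi \x privB_law pi)%E.

Fixpoint exchange pi (x : X) (y : Y) (w : randomness pi)
    (fuel : nat) (h : seq bool) : seq bool :=
  if fuel is fuel'.+1 then
    match turn w.1.1 h with
    | None => h
    | Some Alice => exchange x y w fuel' (rcons h (bitA x w.1 h))
    | Some Bob => exchange x y w fuel' (rcons h (bitB y (w.1.1, w.2) h))
    end
  else h.

Definition transcript pi (x : X) (y : Y) (w : randomness pi) :
    pub pi * seq bool :=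
  (w.1.1, exchange x y w (max_bits pi) [::]).

Definition result pi (x : X) (y : Y) (w : randomness pi) : Z :=
  output (transcript x y w).

Definition performs (f : X -> Y -> Z) (eps : R) pi : Prop :=
  forall x y,
    (randomness_law [set w : randomness pi | result x y w <> f x y]
      <= eps%:E)%E.

(* The public randomness may be continuous, so the transcript need not be a
   discrete random variable.  As usual, its (conditional) mutual information
   with a finite random variable is the supremum over its finite measurable
   quantizations. *)
Definition quantizer pi n (q : pub pi * seq bool -> 'I_n) : Prop :=
  forall h, fiber_measurable (fun r => q (r, h)).

(* The joint law of (q(Pi), X, Y) when (X, Y) ~ mu is independent of the
   randomness. *)
Definition joint_law mu pi n (q : pub pi * seq bool -> 'I_n)
    (u : 'I_n * X * Y) : R :=
  mu (u.1.2, u.2) *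
  fine (randomness_law
          [set w : randomness pi | q (transcript u.1.2 u.2 w) = u.1.1]).

(* I(Pi ; X | Y) *)
Definition info_X_given_Y mu pi : \bar R :=
  ereal_sup [set v | exists n (q : pub pi * seq bool -> 'I_n),
    quantizer q /\ v = (cond_mutual_info (joint_law mu q))%:E].

(* I(Pi ; Y | X) *)
Definition info_Y_given_X mu pi : \bar R :=
  ereal_sup [set v | exists n (q : pub pi * seq bool -> 'I_n),
    quantizer q /\
    v = (cond_mutual_info
          (fun u : 'I_n * Y * X => joint_law mu q (u.1.1, u.2, u.1.2)))%:E].

Definition protocol_IC mu pi : \bar R :=
  (info_X_given_Y mu pi + info_Y_given_X mu pi)%E.

Definition IC mu (f : X -> Y -> Z) (eps : R) : \bar R :=
  ereal_inf [set v | exists pi, performs f eps pi /\ v = protocol_IC mu pi].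

End InformationComplexity.

(* Main.v *)
(* Let [pi] perform [f, eps] and [s = sqrt eps].  The parties run [pi], and then
   check, for every input pair [u = (x, y)] on which the output of the transcript
   [t] is wrong, that the input is not [u]: one of them tells whether his part of
   the input agrees with [u], and only if it does, the other one answers too.  If
   [u] is confirmed they output [f x y], so there is no error left.

   Let [Q y t] be the probability of Bob's bits in [t].  Alice speaks first if
   [s * \sum_y' mu (x, y') * Q y' t <= Q y t].  As [t] is wrong for [u] with
   probability at most [eps = s * s] given [u], the event that [X = x] and Alice
   speaks first has probability at most [s].  When Bob speaks first, comparing
   [Q y] with [s * \sum_y' mu (x, y') * Q y'] for each fixed input of Alice shows
   that the event that [Y = y] and Bob speaks first also has probability at most
   [s].  The second answers are positive with probability at most [eps <= s].
   Hence each of the four additional bits per pair has entropy at most [hhat s].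
   Given [Y] and [t], Bob's bits are determined by Alice's, so that each of the
   two information terms increases by the entropy of only two bits per pair. *)

Require Import Defs.
From HB Require Import structures.
From mathcomp Require Import all_boot all_order all_algebra.
From mathcomp Require Import all_classical all_reals all_analysis.
From mathcomp Require Import measurable_realfun ring lra.

Set Implicit Arguments.
Unset Strict Implicit.
Unset Printing Implicit Defensive.

Import Order.TTheory GRing.Theory Num.Theory.
Import numFieldNormedType.Exports.

Local Open Scope classical_set_scope.
Local Open Scope ring_scope.

(** * Logarithms to base 2 and the binary entropy function *)

Section Log.
Variable R : realType.

Lemma ln2_gt0 : 0 < ln (2 : R).
Proof. by rewrite ln_gt0 ?ltr1n. Qed.

Lemma ler_log2 (a b : R) : 0 < a -> a <= b -> log2 a <= log2 b.
Proof.
move=> a0 ab; rewrite /log2 ler_pM2r ?invr_gt0 ?ln2_gt0//.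
by rewrite ler_ln ?posrE// (lt_le_trans a0).
Qed.

Lemma log2M (a b : R) : 0 < a -> 0 < b -> log2 (a * b) = log2 a + log2 b.
Proof. by move=> a0 b0; rewrite /log2 lnM ?posrE// mulrDl. Qed.

Lemma log2V (a : R) : 0 < a -> log2 a^-1 = - log2 a.
Proof. by move=> a0; rewrite /log2 lnV ?posrE// mulNr. Qed.

Lemma log2_1 : log2 (1 : R) = 0.
Proof. by rewrite /log2 ln1 mul0r. Qed.

Lemma ln_le_sub1 (a : R) : 0 < a -> ln a <= a - 1.
Proof.
move=> a0; have := @le_ln1Dx R (a - 1).
by rewrite addrCA subrr addr0; apply; lra.
Qed.

Lemma log2_le_sub1 (a : R) : 0 < a -> log2 a <= (a - 1) / ln 2.
Proof.
by move=> a0; rewrite /log2 ler_pM2r ?invr_gt0 ?ln2_gt0// ln_le_sub1.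
Qed.

(* [p = 0] is allowed because [0 * log2 0 = 0]. *)
Lemma gibbs_term (p m : R) : 0 <= p -> 0 < m ->
  - (p * log2 p) <= - (p * log2 m) + (m - p) / ln 2.
Proof.
move=> p0 m0; case: (eqVneq p 0) => [->|pn0].
  by rewrite !mul0r oppr0 add0r addr0 divr_ge0// ltW// ln2_gt0.
have pp : 0 < p by rewrite lt_neqAle eq_sym pn0.
have := @log2_le_sub1 (m / p) (divr_gt0 m0 pp).
rewrite log2M ?invr_gt0// log2V// => /(ler_wpM2l p0).
have -> : p * ((m / p - 1) / ln 2) = (m - p) / ln 2.
  by have := ln2_gt0 => l2; field; rewrite pn0 gt_eqF.
by rewrite mulrDr mulrN; lra.
Qed.

(** By Gibbs' inequality the entropy of [p] is at most its cross entropy relative to [m], the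
    truncation of [s] at [1/2]. The cross entropy is affine in [p] with slope
    [log2 (1 - m) - log2 m], which is nonnegative since [m <= 1/2], and equals the entropy of [m] at
    [p = m]. When [m = 1/2] the slope vanishes, which covers [p > m]. *)
Lemma binary_entropy_hhat (p s : R) : 0 <= p -> p <= 1 -> p <= s ->
  binary_entropy p <= hhat s.
Proof.
move=> p0 p1 ps; rewrite /hhat.
set m := Num.min s (1 / 2).
have m2 : m <= 1 / 2 by rewrite ge_min lexx orbT.
have pm : p <= m \/ m = 1 / 2.
  by rewrite /m; case: (leP s (1 / 2)) => _; [left|right].
have m0 : 0 <= m by rewrite le_min (le_trans p0 ps)//=; lra.
clearbody m.
(* Gibbs' inequality needs [m > 0]; the value [m = 0] forces [p = 0]. *)
case: (eqVneq m 0) => [mz|mn0].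
  by have -> : p = m by [apply: le_anti; apply/andP; split; case: pm; lra].
have mp : 0 < m by rewrite lt_neqAle eq_sym mn0.
have m1p : 0 < 1 - m by lra.
have p1' : 0 <= 1 - p by lra.
have g1 := gibbs_term p0 mp.
have g2 := gibbs_term p1' m1p.
have slope : (p - m) * (log2 (1 - m) - log2 m) <= 0.
  case: pm => [pm|->]; last first.
    by have -> : 1 - 1 / 2 = 1 / 2 :> R by [lra]; rewrite subrr mulr0.
  have := @ler_log2 m (1 - m) mp; have le : m <= 1 - m by lra.
  by move=> /(_ le) h; apply: mulr_le0_ge0; lra.
have e : (m - p) / ln 2 + (1 - m - (1 - p)) / ln 2 = 0 :> R.
  by rewrite -mulrDl; have -> : m - p + (1 - m - (1 - p)) = 0 :> R by [ring]; rewrite mul0r.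
rewrite /binary_entropy.
set a := log2 m in g1 slope *; set b := log2 (1 - m) in g2 slope *.
have -> : - (m * a) - (1 - m) * b =
    - (p * a) - (1 - p) * b + (p - m) * (a - b) by ring.
lra.
Qed.

End Log.

(** * Entropy calculus for random variables on a finite weighted space *)

Section FiniteEntropy.
Variables (R : realType) (W : finType) (P : W -> R).
Hypothesis P_ge0 : forall w, 0 <= P w.

(** The law of [V], read at the sample point [w] rather than at a value. Sums then range over [W]
    only, and [V] may take values in an infinite type such as lists of bits. *)
Definition mass (E : eqType) (V : W -> E) (w : W) : R :=
  \sum_(w' | V w' == V w) P w'.

Definition rv_entropy (E : eqType) (V : W -> E) : R :=
  - \sum_w P w * log2 (mass V w).

Definition determines (E E' : Type) (V : W -> E) (V' : W -> E') :=
  forall w w', V w = V w' -> V' w = V' w'.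

Lemma mass_ge (E : eqType) (V : W -> E) w : P w <= mass V w.
Proof.
rewrite /mass (bigD1 w)//= lerDl; exact: sumr_ge0.
Qed.

Lemma mass_eq (E : eqType) (V : W -> E) w w' :
  V w = V w' -> mass V w = mass V w'.
Proof. by rewrite /mass => ->. Qed.

Lemma mass_le (E E' : eqType) (V : W -> E) (V' : W -> E') w :
  determines V V' -> mass V w <= mass V' w.
Proof.
move=> d; rewrite /mass big_mkcond [leRHS]big_mkcond/=.
apply: ler_sum => w' _; case: eqP => [/d ->|_]; first by rewrite eqxx.
by case: eqP.
Qed.

(** The classes of a coarser variable are larger, so the inequality holds at each sample point of
    positive weight. *)
Lemma rv_entropy_le (E E' : eqType) (V : W -> E) (V' : W -> E') :
  determines V V' -> rv_entropy V' <= rv_entropy V.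
Proof.
move=> d; rewrite lerN2; apply: ler_sum => w _.
have := P_ge0 w; rewrite le_eqVlt => /predU1P[<-|Pw]; first by rewrite !mul0r.
rewrite ler_pM2l//; apply: ler_log2; last exact: mass_le.
exact: lt_le_trans (mass_ge V w).
Qed.

Lemma rv_entropy_eq (E E' : eqType) (V : W -> E) (V' : W -> E') :
  determines V V' -> determines V' V -> rv_entropy V = rv_entropy V'.
Proof. by move=> d d'; apply/eqP; rewrite eq_le !rv_entropy_le. Qed.

Lemma sum_class_div_mass (E : eqType) (V : W -> E) (v : E) :
  \sum_(w | V w == v) P w / mass V w <= 1.
Proof.
case: (pickP (fun w => V w == v)) => [w0 /eqP <-|none]; last first.
  by rewrite big_pred0 ?ler01.
under eq_bigr => w /eqP e do rewrite (mass_eq e).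
rewrite -mulr_suml -/(mass V w0).
by case: (eqVneq (mass V w0) 0) => [->|n0]; rewrite ?mul0r ?ler01 ?divff.
Qed.

Lemma mass_ge0 (E : eqType) (V : W -> E) w : 0 <= mass V w.
Proof. exact: sumr_ge0. Qed.

(* The marginals of [(A, C)] and [(B, C)], glued along [C], form a
   sub-probability on the support of [(A, B, C)]. *)
Lemma glued_mass_le (EA EB EC : eqType) (A : W -> EA) (B : W -> EB) (C : W -> EC) :
  \sum_w P w * (mass (fun w => (A w, C w)) w * mass (fun w => (B w, C w)) w /
    (mass (fun w => (A w, (B w, C w))) w * mass C w)) <= \sum_w P w.
Proof.
set D := fun w => (A w, (B w, C w)).
(* Expand the two numerators as sums over [w1] and [w2] and move the sum over [w] inside. For each
   pair with equal [C] there remains one class of [D] divided by its own mass, which is at most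
   1. *)
rewrite [leLHS](_ : _ = \sum_w1 \sum_(w2 | C w2 == C w1) P w1 * P w2 / mass C w1
    * \sum_(w | D w == (A w1, (B w2, C w1))) P w / mass D w); last first.
  transitivity (\sum_w \sum_w1 \sum_w2
     if (A w1 == A w) && (C w1 == C w) && ((B w2 == B w) && (C w2 == C w))
     then P w1 * P w2 / mass C w * (P w / mass D w) else 0).
    apply: eq_bigr => w _.
    rewrite [mass (fun w => (A w, C w)) w]/mass.
    rewrite [mass (fun w => (B w, C w)) w]/mass.
    rewrite [X in X * _ / _]big_mkcond [X in _ * X / _]big_mkcond/=.
    rewrite mulr_suml mulr_suml mulr_sumr; apply: eq_bigr => w1 _.
    rewrite mulr_sumr mulr_suml mulr_sumr; apply: eq_bigr => w2 _.
    rewrite !xpair_eqE invfM.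
    by case: ifP => _; case: ifP => _ /=; ring.
  rewrite exchange_big/=; apply: eq_bigr => w1 _.
  rewrite exchange_big/= [RHS]big_mkcond/=; apply: eq_bigr => w2 _.
  case: ifP => [/eqP c12|c12].
    rewrite mulr_sumr [RHS]big_mkcond/=; apply: eq_bigr => w _.
    rewrite !xpair_eqE c12 (eq_sym (A w)) (eq_sym (B w)) (eq_sym (C w)).
    case: (A w1 == A w) => //=; case: (B w2 == B w) => //=; last by rewrite andbF.
    rewrite andbb; case: eqP => //= e.
    by rewrite (mass_eq e).
  apply: big1 => w _; case: ifP => // /andP[/andP[_ /eqP e1] /andP[_ /eqP e2]].
  by rewrite e1 e2 eqxx in c12.
apply: ler_sum => w1 _.
apply: (@le_trans _ _ (\sum_(w2 | C w2 == C w1) P w1 * P w2 / mass C w1)).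
  apply: ler_sum => w2 _; apply: ler_piMr; last exact: sum_class_div_mass.
  by rewrite divr_ge0 ?mulr_ge0 ?mass_ge0.
rewrite -mulr_suml -mulr_sumr -/(mass C w1).
case: (eqVneq (mass C w1) 0) => [->|n0]; first by rewrite !mulr0 mul0r.
by rewrite mulfK.
Qed.

(** Nonnegativity of [I(A ; B | C)]. Here [t] is the density of the glued measure with respect to
    [P]; the bound [log2 t <= (t - 1) / ln 2] reduces the claim to [glued_mass_le]. *)
Lemma rv_entropy_submodular (EA EB EC : eqType)
    (A : W -> EA) (B : W -> EB) (C : W -> EC) :
  rv_entropy (fun w => (A w, (B w, C w))) + rv_entropy C <=
  rv_entropy (fun w => (A w, C w)) + rv_entropy (fun w => (B w, C w)).
Proof.
rewrite /rv_entropy -!opprD lerN2 -!big_split/= -subr_ge0 -sumrB.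
set D := fun w => (A w, (B w, C w)).
set t := fun w => mass (fun w => (A w, C w)) w * mass (fun w => (B w, C w)) w /
    (mass D w * mass C w).
apply: (@le_trans _ _ (\sum_w P w * (1 - t w) / ln 2)).
  rewrite -mulr_suml divr_ge0 ?(ltW (ln2_gt0 _))//.
  under eq_bigr do rewrite mulrBr mulr1.
  by rewrite sumrB subr_ge0 glued_mass_le.
apply: ler_sum => w _.
have := P_ge0 w; rewrite le_eqVlt => /predU1P[<-|Pw]; first by rewrite !mul0r; lra.
have mp (E : eqType) (V : W -> E) : 0 < mass V w.
  exact: lt_le_trans (mass_ge V w).
have := @log2_le_sub1 R (t w); rewrite /t divr_gt0 ?mulr_gt0// => /(_ isT).
rewrite !(log2M, log2V, invr_gt0, mulr_gt0)// => h.
rewrite -/D -/(t w) -!mulrDr -mulrBr -mulrA ler_pM2l//.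
by move: h; rewrite -/(t w) -[1 - t w]opprB mulNr; lra.
Qed.

Hypothesis P_sum1 : \sum_w P w = 1.

(** Submodularity over a constant [C], whose entropy is 0 because [P] has total mass 1. *)
Lemma rv_entropy_pair (EA EB : eqType) (A : W -> EA) (B : W -> EB) :
  rv_entropy (fun w => (A w, B w)) <= rv_entropy A + rv_entropy B.
Proof.
have := rv_entropy_submodular A B (fun=> tt).
have -> : rv_entropy (fun=> tt) = 0.
  rewrite /rv_entropy big1 ?oppr0// => w _.
  rewrite /mass; under eq_bigl do rewrite eqxx.
  by rewrite P_sum1 log2_1 mulr0.
rewrite addr0 => /le_trans-/(_ (rv_entropy A + rv_entropy B)).
rewrite (@rv_entropy_eq _ _ (fun w => (A w, (B w, tt))) (fun w => (A w, B w))).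
- apply; rewrite lerD// rv_entropy_le// => ? ? -> //.
- by move=> ? ? [-> ->].
- by move=> ? ? [-> ->].
Qed.

Lemma rv_entropy_bool_le (b : W -> bool) (s : R) :
  \sum_(w | b w) P w <= s -> rv_entropy b <= hhat s.
Proof.
set p := \sum_(w | b w) P w => ps.
have p0 : 0 <= p by exact: sumr_ge0.
have pC : \sum_(w | ~~ b w) P w = 1 - p.
  by apply/eqP; rewrite eq_sym subr_eq addrC -P_sum1 [X in X == _](bigID b).
have p1 : p <= 1 by rewrite -subr_ge0 -pC sumr_ge0.
rewrite (_ : rv_entropy b = binary_entropy p) ?binary_entropy_hhat//.
rewrite /rv_entropy (bigID b)/= /binary_entropy opprD.
congr (- _ - _).
  rewrite mulr_suml; apply: eq_bigr => w bw; congr (_ * log2 _).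
  by rewrite /mass bw; apply: eq_bigl => w'; case: (b w').
rewrite -pC mulr_suml; apply: eq_bigr => w /negbTE bw; congr (_ * log2 _).
by rewrite /mass bw; apply: eq_bigl => w'; case: (b w').
Qed.

Lemma rv_entropy_bits (E : eqType) (V : W -> E) (J : Type) (b : J -> W -> bool)
    (s : seq J) (c : R) :
  (forall j, rv_entropy (b j) <= c) ->
  rv_entropy (fun w => (V w, [seq b j w | j <- s])) <=
    rv_entropy V + (size s)%:R * c.
Proof.
move=> h; elim: s => [|j s IH] /=.
  by rewrite mul0r addr0 rv_entropy_le// => ? ? -> //.
have h0 := h j.
have := rv_entropy_pair (fun w => (V w, [seq b j w | j <- s])) (b j).
rewrite (@rv_entropy_eq _ _ _ (fun w => (V w, b j w :: [seq b j w | j <- s]))).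
- by move=> /le_trans; apply; rewrite -natr1; lra.
- by move=> ? ? [-> -> ->].
- by move=> ? ? [-> -> ->].
Qed.

Definition rv_cmi (EA EB EC : eqType) (A : W -> EA) (B : W -> EB) (C : W -> EC) :=
  rv_entropy (fun w => (A w, C w)) - rv_entropy C
  - (rv_entropy (fun w => (A w, (B w, C w))) - rv_entropy (fun w => (B w, C w))).

(** Data processing: [F] is a function of [V = (Q, Y, bits)], so it tells no more about [X] given
    [Y] than [V] does. Passing from [Q] to [V] raises the entropy given [Y] by at most [c] per bit
    and does not lower the entropy given [(X, Y)]. *)
Lemma rv_cmi_bits (EF EQ EX EY : eqType) (F : W -> EF) (Q : W -> EQ)
    (X : W -> EX) (Y : W -> EY) (J : Type) (b : J -> W -> bool) (s : seq J) (c : R) :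
  (forall j, rv_entropy (b j) <= c) ->
  determines (fun w => (Q w, Y w, [seq b j w | j <- s])) F ->
  rv_cmi F X Y <= rv_cmi Q X Y + (size s)%:R * c.
Proof.
move=> hc dF; rewrite /rv_cmi.
set V := fun w => (Q w, Y w, [seq b j w | j <- s]).
have h1 := rv_entropy_submodular V X (fun w => (F w, Y w)).
have h2 := rv_entropy_bits (fun w => (Q w, Y w)) s hc.
have h3 : rv_entropy (fun w => (V w, (F w, Y w))) <= rv_entropy V.
  by apply: rv_entropy_le => w w' e; rewrite e (dF _ _ e); case: e => _ -> _.
have h4 : rv_entropy (fun w => (Q w, (X w, Y w)))
    <= rv_entropy (fun w => (V w, (X w, (F w, Y w)))).
  by apply: rv_entropy_le => w w' [-> _ _ -> _ ->].
have h5 : rv_entropy (fun w => (X w, (F w, Y w)))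
    <= rv_entropy (fun w => (F w, (X w, Y w))).
  by apply: rv_entropy_le => w w' [-> -> ->].
move: h2; rewrite -/V => h2.
lra.
Qed.

Lemma sum_law (E : finType) (V : W -> E) (g : E -> R) :
  \sum_e (\sum_(w | V w == e) P w) * g e = \sum_w P w * g (V w).
Proof.
rewrite [RHS](partition_big V xpredT)//=; apply: eq_bigr => e _.
by rewrite mulr_suml; apply: eq_bigr => w /eqP ->.
Qed.

(** The chain rule [H(U | V) = H(U, V) - H(V)], linking the averaged definition of conditional
    entropy to [rv_entropy]. *)
Lemma cond_entropyE (A C : finType) (U : W -> A) (V : W -> C) :
  cond_entropy (fun u => \sum_(w | (U w, V w) == u) P w) =
  rv_entropy (fun w => (U w, V w)) - rv_entropy V.
Proof.
have marg c : \sum_a \sum_(w | (U w, V w) == (a, c)) P w = \sum_(w | V w == c) P w.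
  rewrite [RHS](partition_big U xpredT)//=; apply: eq_bigr => a _.
  by apply: eq_bigl => w; rewrite xpair_eqE andbC.
pose p (u : A * C) := \sum_(w | (U w, V w) == u) P w.
pose pc c := \sum_(w | V w == c) P w.
have p_ge0 u : 0 <= p u by exact: sumr_ge0.
transitivity (- \sum_c \sum_a p (a, c) * log2 (p (a, c) / pc c)).
  rewrite /cond_entropy -sumrN; apply: eq_bigr => c _.
  rewrite !marg /entropy mulrN mulr_sumr; congr (- _); apply: eq_bigr => a _.
  (* A value [c] of probability 0 makes every [p (a, c)] vanish, so both sides are 0 in spite of the
     division by [pc c]. *)
  rewrite -/(pc c) -/(p (a, c)) mulrA; case: (eqVneq (pc c) 0) => [pc0|n0].
    rewrite pc0 !mul0r.
    suff -> : p (a, c) = 0 by rewrite mul0r.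
    apply/eqP; rewrite eq_le p_ge0 andbT -pc0 /pc -marg (bigD1 a)//= lerDl.
    by apply: sumr_ge0 => i _; exact: p_ge0.
  by rewrite [pc c * _]mulrC divfK.
rewrite exchange_big/=.
rewrite (pair_bigA _ (fun a c => p (a, c) * log2 (p (a, c) / pc c)))/=.
transitivity (- \sum_(e : A * C) p e * log2 (p e / pc e.2)).
  by congr (- _); apply: eq_bigr => -[a c] _.
rewrite (sum_law (fun w => (U w, V w)) (fun e => log2 (p e / pc e.2)))/=.
rewrite /rv_entropy opprK -!sumrN -big_split/=; apply: eq_bigr => w _.
have := P_ge0 w; rewrite le_eqVlt => /predU1P[<-|Pw]; first by rewrite !mul0r; lra.
have mp (E : eqType) (T : W -> E) : 0 < mass T w.
  exact: lt_le_trans (mass_ge T w).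
rewrite -[p _]/(mass (fun w => (U w, V w)) w) -[pc _]/(mass V w).
by rewrite log2M ?invr_gt0// log2V//; ring.
Qed.

Lemma cond_mutual_infoE (A B C : finType) (T : W -> A) (U : W -> B) (V : W -> C) :
  cond_mutual_info (fun u => \sum_(w | (T w, U w, V w) == u) P w) =
  rv_cmi T U V.
Proof.
rewrite /cond_mutual_info /rv_cmi.
have -> : (fun u : A * C => \sum_b \sum_(w | (T w, U w, V w) == (u.1, b, u.2)) P w) =
    (fun u => \sum_(w | (T w, V w) == u) P w).
  apply/funext => -[a c] /=.
  rewrite [RHS](partition_big U xpredT)//=; apply: eq_bigr => b _.
  by apply: eq_bigl => w; rewrite !xpair_eqE -!andbA; do !bool_congr.
rewrite cond_entropyE; congr (_ - _).
rewrite -(cond_entropyE T (fun w => (U w, V w))); congr cond_entropy.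
apply/funext => -[a [b c]] /=.
by apply: eq_bigl => w; rewrite !xpair_eqE andbA.
Qed.

End FiniteEntropy.

(* Unlike [fiber_measurable], this is stable under composition with any function
   on [K], whatever [K] is. *)
Definition discretely_measurable d (T : measurableType d) (K : Type) (g : T -> K) :=
  forall S : set K, measurable (g @^-1` S).

(** * Maps all of whose preimages are measurable *)

Section DiscreteMeasurable.
Context d (T : measurableType d).

Lemma discretely_measurable_fiber (K : Type) (g : T -> K) :
  discretely_measurable g -> fiber_measurable g.
Proof. by move=> mg k; exact: mg [set k]. Qed.

Lemma fiber_discretely_measurable (K : countType) (g : T -> K) :
  fiber_measurable g -> discretely_measurable g.
Proof.
move=> mg S.
have -> : g @^-1` S = \bigcup_k (if `[< S k >] then [set t | g t = k] else set0).
  apply/seteqP; split=> [t St|t [k _]].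
    by exists (g t) => //; rewrite asboolT.
  by case: ifPn => // /asboolP Sk /= ->.
apply: countable_bigcupT_measurable => [|k]; first exact: countableP.
by case: ifP => _; [exact: mg|exact: measurable0].
Qed.

Lemma discretely_measurable_cst (K : Type) (k : K) :
  discretely_measurable (fun _ : T => k).
Proof.
move=> S; have [Sk|Sk] := pselect (S k).
  by have -> : (fun=> k) @^-1` S = [set: T] by apply/seteqP; split.
by have -> : (fun=> k) @^-1` S = set0 :> set T by apply/seteqP; split.
Qed.

Lemma discretely_measurable_comp (K L : Type) (F : K -> L) (g : T -> K) :
  discretely_measurable g -> discretely_measurable (fun t => F (g t)).
Proof. by move=> mg S; exact: mg (F @^-1` S). Qed.

(** The countably many values of [g] cut the space into measurable pieces, on each of which the map
    coincides with one fixed [F k]. *)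
Lemma discretely_measurable_bind (K : countType) (L : Type) (g : T -> K)
    (F : K -> T -> L) :
  discretely_measurable g -> (forall k, discretely_measurable (F k)) ->
  discretely_measurable (fun t => F (g t) t).
Proof.
move=> mg mF S.
have -> : (fun t => F (g t) t) @^-1` S =
    \bigcup_k ((g @^-1` [set k]) `&` (F k @^-1` S)).
  apply/seteqP; split=> [t St|t [k _ [/= <-]]//]; by exists (g t).
apply: countable_bigcupT_measurable => [|k]; first exact: countableP.
by apply: measurableI; [exact: mg|exact: mF].
Qed.

Lemma discretely_measurable_if (L : Type) (b : T -> bool) (f g : T -> L) :
  discretely_measurable b -> discretely_measurable f -> discretely_measurable g ->
  discretely_measurable (fun t => if b t then f t else g t).
Proof.
move=> mb mf mg.
by apply: (discretely_measurable_bind (F := fun (b : bool) t => if b then f t else g t)) => // -[].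
Qed.

Lemma discretely_measurable_pair (K : countType) (L : Type) (f : T -> K) (g : T -> L) :
  discretely_measurable f -> discretely_measurable g ->
  discretely_measurable (fun t => (f t, g t)).
Proof.
move=> mf mg; apply: (discretely_measurable_bind (F := fun k t => (k, g t))) => // k.
exact: discretely_measurable_comp.
Qed.

Lemma discretely_measurable_all (I : Type) (s : seq I) (b : I -> T -> bool) :
  (forall i, discretely_measurable (b i)) ->
  discretely_measurable (fun t => all (fun i => b i t) s).
Proof.
move=> mb; elim: s => [|i s IH] /=; first exact: discretely_measurable_cst.
by apply: discretely_measurable_if => //; exact: discretely_measurable_cst.
Qed.

Lemma discretely_measurable_find (I : Type) (s : seq I) (b : I -> T -> bool) :
  (forall i, discretely_measurable (b i)) ->
  discretely_measurable (fun t => find (fun i => b i t) s).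
Proof.
move=> mb; elim: s => [|i s IH] /=; first exact: discretely_measurable_cst.
apply: discretely_measurable_if => //; first exact: discretely_measurable_cst.
exact: discretely_measurable_comp.
Qed.

Lemma discretely_measurable_ffun (J K : finType) (g : J -> T -> K) :
  (forall i, discretely_measurable (g i)) ->
  discretely_measurable (fun t => [ffun i => g i t]).
Proof.
move=> mg; apply: fiber_discretely_measurable => phi.
have -> : [set t | [ffun i => g i t] = phi] =
    \bigcap_(i in setT) (g i @^-1` [set phi i]).
  apply/seteqP; split=> [t /= <- i _|t h]; first by rewrite /= ffunE.
  by apply/ffunP => i; rewrite ffunE; exact: (h i I).
apply: fin_bigcap_measurable => // i _; exact: mg.
Qed.

Lemma discretely_measurableT_comp d' (T' : measurableType d') (K : Type)
    (phi : T' -> T) (g : T -> K) :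
  measurable_fun setT phi -> discretely_measurable g ->
  discretely_measurable (fun t => g (phi t)).
Proof.
by move=> mphi mg S; rewrite -[X in measurable X]setTI; exact: (mphi measurableT _ (mg S)).
Qed.

Lemma measurable_pred_discrete (b : T -> bool) :
  measurable [set t | b t] -> discretely_measurable b.
Proof.
move=> mb; apply: fiber_discretely_measurable => -[] //.
rewrite (_ : [set t | b t = false] = ~` [set t | b t]); first exact: measurableC.
by apply/seteqP; split=> t /=; [move=> ->|move/negP/negbTE].
Qed.

End DiscreteMeasurable.

(** * Probabilities of events as real numbers *)

Section Probability.
Context d (T : measurableType d) (R : realType) (P : probability T R).

Definition prob (S : set T) : R := fine (P S).

Lemma prob_ge0 S : 0 <= prob S.
Proof. exact: fine_ge0. Qed.

Lemma probE S : measurable S -> (prob S)%:E = P S.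
Proof. by move=> mS; rewrite fineK// fin_num_measure. Qed.

Lemma prob_le1 S : measurable S -> prob S <= 1.
Proof. by move=> mS; rewrite -lee_fin probE// probability_le1. Qed.

Lemma le_prob A B : measurable A -> measurable B -> A `<=` B -> prob A <= prob B.
Proof. by move=> mA mB AB; rewrite -lee_fin !probE// le_measure ?inE. Qed.

(** The values are listed by [L] instead of forming a finite type: it will be applied to
    transcripts, which are bit strings of bounded length. *)
Lemma prob_partition (K : eqType) (g : T -> K) (L : seq K) (Q : pred K) :
  discretely_measurable g -> uniq L -> (forall t, g t \in L) ->
  prob [set t | Q (g t)] = \sum_(k <- L | Q k) prob [set t | g t = k].
Proof.
move=> mg uL gL.
have -> : [set t | Q (g t)] = [set t | (g t \in L) && Q (g t)].
  by apply/seteqP; split=> t /=; rewrite gL.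
elim: L uL {gL} => [_|k L IH /= /andP[kL /IH{}IH]].
  by rewrite big_nil (_ : [set t | _] = set0) /prob ?measure0// -subset0.
rewrite big_cons -IH; case: ifPn => Qk.
  rewrite (_ : [set t | _] = [set t | g t = k] `|` [set t | (g t \in L) && Q (g t)]).
    rewrite /prob measureU.
    - by rewrite fineD// fin_num_measure//; [exact: (mg [set k])|exact: (mg [set k | (k \in L) && Q k])].
    - exact: (mg [set k]).
    - exact: (mg [set k | (k \in L) && Q k]).
    - by rewrite -subset0 => t /= [->]; rewrite (negbTE kL).
  apply/seteqP; split=> t /=; rewrite inE.
    by move=> /andP[/orP[/eqP ->|gL] Qg]; [left|right; rewrite gL].
  by move=> [->|/andP[-> ->]]; rewrite ?eqxx ?Qk// orbT.
congr prob; apply/seteqP; split=> t /=; rewrite inE.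
  by move=> /andP[/orP[/eqP ->|->//]]; rewrite (negbTE Qk).
by move=> /andP[-> ->]; rewrite orbT.
Qed.

Lemma prob_partition_fin (K : finType) (g : T -> K) (Q : pred K) :
  discretely_measurable g ->
  prob [set t | Q (g t)] = \sum_(k | Q k) prob [set t | g t = k].
Proof.
move=> mg; rewrite (prob_partition Q mg (enum_uniq K)); last first.
  by move=> t; rewrite mem_enum.
by rewrite big_enum_cond; apply: eq_bigl => k; rewrite andTb.
Qed.

Lemma sum_prob1 (K : finType) (g : T -> K) :
  discretely_measurable g -> \sum_k prob [set t | g t = k] = 1.
Proof.
move=> mg; rewrite -(prob_partition_fin predT mg) /prob.
by rewrite (_ : [set t | _] = setT) ?probability_setT//; apply/seteqP; split.
Qed.

End Probability.

Lemma measurable_prob_xsection d1 d2 (T1 : measurableType d1)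
    (T2 : measurableType d2) (R : realType) (P2 : probability T2 R)
    (S : set (T1 * T2)) :
  measurable S -> measurable_fun setT (fun t => prob P2 (xsection S t)).
Proof.
move=> mS; apply/measurable_EFinP; rewrite [X in measurable_fun _ X](_ : _ = P2 \o xsection S).
  exact: measurable_fun_xsection.
by apply/funext => t /=; rewrite probE//; exact: measurable_xsection.
Qed.

(* This replaces Fubini's theorem. *)
Lemma product_prob_le d1 d2 (T1 : measurableType d1) (T2 : measurableType d2)
    (R : realType) (P1 : probability T1 R) (P2 : probability T2 R)
    (I : finType) (c e : I -> R) (S : I -> set (T1 * T2)) :
  (forall i, measurable (S i)) -> (forall i, 0 <= c i) -> (forall i, 0 <= e i) ->
  (forall t, \sum_i c i * prob P2 (xsection (S i) t)
    <= \sum_i e i * prob P2 (xsection (S i) t)) ->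
  \sum_i c i * fine ((P1 \x P2)%E (S i)) <= \sum_i e i * fine ((P1 \x P2)%E (S i)).
Proof.
move=> mS c0 e0 le.
(* A combination of product probabilities is the integral over the first factor of the same
   combination of section probabilities, so it suffices to compare section by section. *)
have comb (k : I -> R) : (forall i, 0 <= k i) ->
    (\sum_i k i * fine ((P1 \x P2)%E (S i)))%:E =
    (\int[P1]_t (\sum_i k i * prob P2 (xsection (S i) t))%:E)%E.
  move=> k0; under eq_integral do rewrite -sumEFin.
  rewrite ge0_integral_sum//.
  - rewrite -sumEFin; apply: eq_bigr => i _; rewrite EFinM.
    rewrite (probE (P1 \x P2 : probability (T1 * T2)%type R)%E)//.
    rewrite -ge0_integralZl_EFin//; last exact: measurable_fun_xsection.
    by apply: eq_integral => t _; rewrite EFinM probE//; exact: measurable_xsection.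
  - move=> i; under eq_fun do [rewrite EFinM probE; last exact: measurable_xsection].
    by apply: measurable_funeM; exact: measurable_fun_xsection.
  - by move=> i t _; rewrite lee_fin mulr_ge0// prob_ge0.
have meas (k : I -> R) :
    measurable_fun setT (fun t => \sum_i k i * prob P2 (xsection (S i) t)).
  apply: measurable_sum => i; apply: measurable_funM => //.
  exact: measurable_prob_xsection.
rewrite -lee_fin !comb//; apply: ge0_le_integral => //.
- by move=> t _; rewrite lee_fin sumr_ge0// => i _; rewrite mulr_ge0// prob_ge0.
- exact/measurable_EFinP.
- exact/measurable_EFinP.
- by move=> t _; rewrite lee_fin.
Qed.

(** * Rectangle structure of the transcripts of a protocol *)

Section Exchange.
Variables (R : realType) (X Y Z : finType) (pi : protocol R X Y Z).

(** Complete transcripts: the communication is over after [h] and after no proper prefix of it. *)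
Definition ended (r : pub pi) (h : seq bool) :=
  ~~ isSome (turn r h) && all (fun k => isSome (turn r (take k h))) (iota 0 (size h)).

(** Since [turn] reads only the public string, consistency of [h] with Alice's messages is an event
    of her own randomness and the public one. *)
Definition alice_agrees (x : X) (h : seq bool) (ra : pub pi * privA pi) :=
  all (fun k => if turn ra.1 (take k h) is Some Alice
                then bitA x ra (take k h) == nth false h k else true)
      (iota 0 (size h)).

Definition bob_agrees (y : Y) (h : seq bool) (rb : pub pi * privB pi) :=
  all (fun k => if turn rb.1 (take k h) is Some Bob
                then bitB y rb (take k h) == nth false h k else true)
      (iota 0 (size h)).

Definition final (x : X) (y : Y) (w : randomness pi) : seq bool :=
  exchange x y w (max_bits pi) [::].

(** Loop invariant: the remaining fuel always suffices to reach length [max_bits], where [turn] is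
    [None], so the exchange stops for lack of a speaker and every bit added is the speaker's. *)
Lemma exchange_extends x y (w : randomness pi) fuel h :
  (max_bits pi <= size h + fuel)%N ->
  let h' := exchange x y w fuel h in
  [/\ take (size h) h' = h, turn w.1.1 h' = None &
   forall k, (size h <= k < size h')%N ->
     match turn w.1.1 (take k h') with
     | None => False
     | Some Alice => bitA x w.1 (take k h') = nth false h' k
     | Some Bob => bitB y (w.1.1, w.2) (take k h') = nth false h' k
     end].
Proof.
elim: fuel h => [|fuel IH] h /= hM.
  rewrite addn0 in hM; rewrite take_size turn_bounded//; split=> // k.
  by rewrite leqNgt andNb.
have done b : (turn w.1.1 h <> None) ->
    match turn w.1.1 h with
     | None => False
     | Some Alice => bitA x w.1 h = b
     | Some Bob => bitB y (w.1.1, w.2) h = b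
     end ->
  let h' := exchange x y w fuel (rcons h b) in
  [/\ take (size h) h' = h, turn w.1.1 h' = None &
   forall k, (size h <= k < size h')%N ->
     match turn w.1.1 (take k h') with
     | None => False
     | Some Alice => bitA x w.1 (take k h') = nth false h' k
     | Some Bob => bitB y (w.1.1, w.2) (take k h') = nth false h' k
     end].
  move=> tn tb; have := IH (rcons h b).
  rewrite size_rcons addSnnS => /(_ hM) /=; set h' := exchange _ _ _ _ _.
  move=> [tk te all_ok].
  have tk' : take (size h) h' = h.
    by have := congr1 (take (size h)) tk; rewrite take_takel// -cats1 take_size_cat// => ->.
  split=> // k; rewrite leq_eqVlt => /andP[/predU1P[<- kh|? ?]]; last first.
    by apply: all_ok; apply/andP.
  rewrite tk' (_ : nth false h' (size h) = b)//.
  by rewrite -(nth_take false (ltnSn (size h))) tk nth_rcons ltnn eqxx.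
case e : (turn w.1.1 h) => [[]|].
- by apply: done; rewrite e.
- by apply: done; rewrite e.
- rewrite take_size; split=> // k; by rewrite leqNgt andNb.
Qed.

(** Converse direction: started from any prefix of a complete consistent [h], the exchange can only
    follow [h]. *)
Lemma exchange_prefix x y (w : randomness pi) h fuel g :
  take (size g) h = g -> (size g <= size h <= size g + fuel)%N ->
  ended w.1.1 h -> alice_agrees x h w.1 -> bob_agrees y h (w.1.1, w.2) ->
  exchange x y w fuel g = h.
Proof.
move=> + + /andP[he /allP hs] /allP ha /allP hb.
elim: fuel g => [|fuel IH] g gh /= /andP[gl gu].
  by rewrite -gh (_ : size g = size h) ?take_size//; apply/eqP; rewrite eqn_leq gl -(addn0 (size g)).
have [e|gn] := eqVneq (size g) (size h).
  by rewrite e take_size in gh; rewrite -gh; case: (turn _ _) he.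
have {gl gn}gl : (size g < size h)%N by rewrite ltn_neqAle gn.
have gi : size g \in iota 0 (size h) by rewrite mem_iota.
have next b : nth false h (size g) = b -> exchange x y w fuel (rcons g b) = h.
  move=> hb'; apply: IH; rewrite size_rcons.
    by rewrite (take_nth false)// gh hb'.
  by rewrite gl addSnnS.
have := hs _ gi; have := ha _ gi; have := hb _ gi; rewrite gh /=.
case: (turn w.1.1 g) => [[]|] //.
- by move=> _ /eqP e _; apply: next; rewrite e.
- by move=> /eqP e _ _; apply: next; rewrite e.
Qed.

Lemma ended_size r h : ended r h -> (size h <= max_bits pi)%N.
Proof.
move=> /andP[_ /allP hs]; rewrite leqNgt; apply/negP => lt.
have := hs (max_bits pi); rewrite mem_iota lt => /(_ isT).
by rewrite turn_bounded// size_takel// ltnW.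
Qed.

(** The rectangle property: for fixed public randomness, a transcript occurs exactly when one
    condition on Alice and one on Bob hold. *)
Lemma final_eqE x y (w : randomness pi) h :
  (final x y w == h) =
  [&& ended w.1.1 h, alice_agrees x h w.1 & bob_agrees y h (w.1.1, w.2)].
Proof.
apply/eqP/idP => [<-|/and3P[he ha hb]]; last first.
  apply: exchange_prefix => //=; first by rewrite take0.
  exact: ended_size he.
have := @exchange_extends x y w (max_bits pi) [::] (leqnn _).
rewrite -/(final x y w); set h' := final x y w => -[_ hn ok].
rewrite /ended hn /=; apply/and3P; split; apply/allP => k;
  rewrite mem_iota add0n => /ok /=;
  case: (turn w.1.1 (take k h')) => [[]|]// ->; exact: eqxx.
Qed.

Lemma ended_final x y (w : randomness pi) : ended w.1.1 (final x y w).
Proof. by have := eqxx (final x y w); rewrite {1}final_eqE => /and3P[]. Qed.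

Lemma size_final x y (w : randomness pi) : (size (final x y w) <= max_bits pi)%N.
Proof. exact: ended_size (ended_final x y w). Qed.

Definition bit_strings (n : nat) : seq (seq bool) :=
  undup [seq bseqval t | t : n.-bseq bool].

Lemma mem_bit_strings n (s : seq bool) : (size s <= n)%N -> s \in bit_strings n.
Proof.
move=> sn; rewrite mem_undup; apply/mapP; exists (Bseq sn) => //.
by rewrite mem_enum.
Qed.

Lemma turn_discretely_measurable h : discretely_measurable (fun r : pub pi => turn r h).
Proof.
(* Turns are coded by natural numbers to bring them into a countable type. *)
pose code (p : option party) : nat :=
  match p with None => 0 | Some Alice => 1 | Some Bob => 2 end.
pose decode n := match n with 0 => None | 1 => Some Alice | _ => Some Bob end.
have codeK p : decode (code p) = p by case: p => [[]|].
have mc : discretely_measurable (T := pub pi) (K := nat) (fun r => code (turn r h)).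
  apply: fiber_discretely_measurable => n.
  have [en|ne] := eqVneq (code (decode n)) n.
    rewrite (_ : [set t | _] = [set t | turn t h = decode n]).
      exact: turn_measurable.
    by apply/seteqP; split=> r /= => [<-|->]//; rewrite codeK.
  rewrite (_ : [set t | _] = set0)// -subset0 => r /= e.
  by move: ne; rewrite -e codeK eqxx.
have -> : (fun r : pub pi => turn r h) = (fun r => decode (code (turn r h))).
  by apply/funext => r; rewrite codeK.
exact: (discretely_measurable_comp decode mc).
Qed.

Lemma bitA_discretely_measurable x h : discretely_measurable (fun ra => @bitA _ _ _ _ pi x ra h).
Proof. by apply: fiber_discretely_measurable; exact: bitA_measurable. Qed.

Lemma bitB_discretely_measurable y h : discretely_measurable (fun rb => @bitB _ _ _ _ pi y rb h).
Proof. by apply: fiber_discretely_measurable; exact: bitB_measurable. Qed.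

Lemma ended_measurable h : discretely_measurable (fun r => ended r h).
Proof.
apply: discretely_measurable_if; last exact: discretely_measurable_cst.
  exact: (discretely_measurable_comp (fun p => ~~ isSome p) (turn_discretely_measurable h)).
apply: discretely_measurable_all => k.
exact: (discretely_measurable_comp isSome (turn_discretely_measurable _)).
Qed.

Lemma agrees_measurable d (T : measurableType d) (phi : T -> pub pi)
    (b : T -> seq bool -> bool) (p : party) h :
  measurable_fun setT phi -> (forall h', discretely_measurable (b ^~ h')) ->
  discretely_measurable (fun t =>
    all (fun k => if (if turn (phi t) (take k h) is Some q then
                        match p, q with Alice, Alice | Bob, Bob => true | _, _ => false end
                      else false)
                  then b t (take k h) == nth false h k else true)
        (iota 0 (size h))).
Proof.
move=> mphi mb; apply: discretely_measurable_all => k.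
apply: discretely_measurable_if; last exact: discretely_measurable_cst.
  apply: (discretely_measurable_comp (fun q => if q is Some q then
     match p, q with Alice, Alice | Bob, Bob => true | _, _ => false end else false)).
  exact: discretely_measurableT_comp mphi (turn_discretely_measurable _).
exact: (discretely_measurable_comp (fun c => c == nth false h k) (mb _)).
Qed.

Lemma alice_agrees_measurable x h : discretely_measurable (alice_agrees x h).
Proof.
have M := agrees_measurable Alice h (@measurable_fst _ _ (pub pi) (privA pi))
  (bitA_discretely_measurable x).
move: M; set F := (F in discretely_measurable F); suff -> : alice_agrees x h = F by [].
by apply/funext => t; apply: eq_all => k; case: (turn _ _) => [[]|].
Qed.

Lemma bob_agrees_measurable y h : discretely_measurable (bob_agrees y h).
Proof.
have M := agrees_measurable Bob h (@measurable_fst _ _ (pub pi) (privB pi))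
  (bitB_discretely_measurable y).
move: M; set F := (F in discretely_measurable F); suff -> : bob_agrees y h = F by [].
by apply/funext => t; apply: eq_all => k; case: (turn _ _) => [[]|].
Qed.

Lemma measurable_pub : measurable_fun setT (fun w : pub pi * privA pi * privB pi => w.1.1).
Proof. exact: measurableT_comp measurable_fst measurable_fst. Qed.

Lemma measurable_pub_privB :
  measurable_fun setT (fun w : pub pi * privA pi * privB pi => (w.1.1, w.2)).
Proof. exact: measurable_fun_pair measurable_pub measurable_snd. Qed.

Lemma final_measurable x y : discretely_measurable
  (final x y : pub pi * privA pi * privB pi -> seq bool).
Proof.
apply: fiber_discretely_measurable => h.
rewrite (_ : [set w | _] = [set w | [&& ended w.1.1 h, alice_agrees x h w.1
    & bob_agrees y h (w.1.1, w.2)]]); last first.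
  by apply/seteqP; split=> w /=; rewrite -final_eqE => /eqP.
have M : discretely_measurable (fun w : pub pi * privA pi * privB pi =>
    [&& ended w.1.1 h, alice_agrees x h w.1 & bob_agrees y h (w.1.1, w.2)]).
  apply: discretely_measurable_if; last exact: discretely_measurable_cst.
    exact: discretely_measurableT_comp measurable_pub (ended_measurable h).
  apply: discretely_measurable_if; last exact: discretely_measurable_cst.
    exact: discretely_measurableT_comp measurable_fst (alice_agrees_measurable x h).
  exact: discretely_measurableT_comp measurable_pub_privB (bob_agrees_measurable y h).
exact: (M [set true]).
Qed.

Lemma transcript_measurable (K : Type) (F : pub pi -> seq bool -> K) x y :
  (forall h, discretely_measurable (F ^~ h)) ->
  discretely_measurable (fun w : pub pi * privA pi * privB pi => F w.1.1 (final x y w)).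
Proof.
move=> mF; apply: (discretely_measurable_bind (F := fun h w => F w.1.1 h)).
  exact: final_measurable.
by move=> h; exact: discretely_measurableT_comp measurable_pub (mF h).
Qed.

Definition law : probability (pub pi * privA pi * privB pi)%type R :=
  (pub_law pi \x privA_law pi \x privB_law pi)%E.

(** The quantity [Q y t] of the overview, with the transcript [t] split into its bits [h] and the
    public string [r]. *)
Definition bob_prob (y : Y) (h : seq bool) (r : pub pi) : R :=
  prob (privB_law pi) (xsection [set rb | bob_agrees y h rb] r).

Definition event_prob (D : pub pi -> seq bool -> bool) (x : X) (y : Y) : R :=
  prob law [set w | D w.1.1 (final x y w)].

Lemma measurable_bob_prob y h : measurable_fun setT (bob_prob y h).
Proof.
by apply: measurable_prob_xsection; exact: (bob_agrees_measurable y h [set true]).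
Qed.

(* Given the public randomness and Alice's, the probability of a transcript
   depends on [y] only through [bob_prob y]. *)
Lemma event_section_prob (D : pub pi -> seq bool -> bool) x y
    (t : pub pi * privA pi) :
  (forall h, discretely_measurable (D ^~ h)) ->
  prob (privB_law pi) (xsection [set w | D w.1.1 (final x y w)] t) =
  \sum_(h <- bit_strings (max_bits pi) | D t.1 h)
     (ended t.1 h && alice_agrees x h t)%:R * bob_prob y h t.1.
Proof.
move=> mD.
rewrite (_ : xsection _ t = [set b | D t.1 (final x y (t, b))]); last first.
  by apply/seteqP; split=> b; rewrite /xsection /= inE.
rewrite (@prob_partition _ _ _ _ _ (fun b => final x y (t, b))
  (bit_strings (max_bits pi)) (D t.1)).
- apply: eq_bigr => h _.
  rewrite (_ : [set b | final x y (t, b) = h] =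
    [set b | [&& ended t.1 h, alice_agrees x h t & bob_agrees y h (t.1, b)]]); last first.
    by apply/seteqP; split=> b /=; rewrite -(final_eqE x y (t, b)) => /eqP.
  case: (ended t.1 h) => /=; last by rewrite mul0r (_ : [set _ | _] = set0) /prob ?measure0// -subset0.
  case: (alice_agrees x h t) => /=; last by rewrite mul0r (_ : [set _ | _] = set0) /prob ?measure0// -subset0.
  rewrite mul1r /bob_prob; congr prob.
  by apply/seteqP; split=> b; rewrite /xsection /= inE.
- have := discretely_measurableT_comp (pair1_measurable t) (final_measurable x y).
  exact.
- exact: undup_uniq.
- by move=> b; apply: mem_bit_strings; exact: size_final.
Qed.

(** Alice's factor in the probability of a transcript depends on [x] only. A linear inequality
    between the [bob_prob] on every transcript in [D] can thus be multiplied by it, summed over [D]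
    and integrated. *)
Lemma event_prob_le (D : pub pi -> seq bool -> bool) (c e : Y -> R) (x : X) :
  (forall h, discretely_measurable (D ^~ h)) ->
  (forall y, 0 <= c y) -> (forall y, 0 <= e y) ->
  (forall r h, D r h ->
     \sum_y c y * bob_prob y h r <= \sum_y e y * bob_prob y h r) ->
  \sum_y c y * event_prob D x y <= \sum_y e y * event_prob D x y.
Proof.
move=> mD c0 e0 le; apply: product_prob_le => // [y|t].
  exact: (transcript_measurable x y mD [set true]).
under eq_bigr do rewrite event_section_prob// mulr_sumr.
under [leRHS]eq_bigr do rewrite event_section_prob// mulr_sumr.
rewrite exchange_big [leRHS]exchange_big /=; apply: ler_sum => h Dh.
under eq_bigr do rewrite mulrCA; under [leRHS]eq_bigr do rewrite mulrCA.
by rewrite -!mulr_sumr ler_wpM2l// le.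
Qed.

Lemma event_prob_ge0 D x y : 0 <= event_prob D x y.
Proof. exact: prob_ge0. Qed.

Lemma event_prob_le1 (D : pub pi -> seq bool -> bool) x y :
  (forall h, discretely_measurable (D ^~ h)) -> event_prob D x y <= 1.
Proof. by move=> mD; apply: prob_le1; exact: (transcript_measurable x y mD [set true]). Qed.

End Exchange.

(** * Appending rounds to a protocol whose bits depend on the inputs and on a class of the
    transcript *)

Section Extension.
Variables (R : realType) (X Y Z : finType) (pi : protocol R X Y Z).
Variables (K : finType) (c : pub pi -> seq bool -> K).
Hypothesis c_measurable : forall h, discretely_measurable (c ^~ h).
Variables (N : nat) (sched : nat -> party).
Variables (mA : K -> X -> seq bool -> bool) (mB : K -> Y -> seq bool -> bool).
Variable o : K -> seq bool -> Z.

(* The length of the transcript of [pi] inside [h], or [(size h).+1] if [pi]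
   is not finished after [h]. *)
Definition cut (r : pub pi) (h : seq bool) :=
  find (fun k => ~~ isSome (turn r (take k h))) (iota 0 (size h).+1).

(** The test [cut r h <= size h] says that [pi] has ended inside [h]; [size h - cut r h] is then the
    number of appended bits so far. *)
Definition ext_turn (r : pub pi) (h : seq bool) : option party :=
  if (cut r h <= size h)%N then
    if (size h - cut r h < N)%N then Some (sched (size h - cut r h)) else None
  else turn r h.

Definition ext_bitA (x : X) (ra : pub pi * privA pi) (h : seq bool) : bool :=
  if (cut ra.1 h <= size h)%N then
    mA (c ra.1 (take (cut ra.1 h) h)) x (drop (cut ra.1 h) h)
  else bitA x ra h.

Definition ext_bitB (y : Y) (rb : pub pi * privB pi) (h : seq bool) : bool :=
  if (cut rb.1 h <= size h)%N then
    mB (c rb.1 (take (cut rb.1 h) h)) y (drop (cut rb.1 h) h)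
  else bitB y rb h.

Definition ext_output (u : pub pi * seq bool) : Z :=
  o (c u.1 (take (cut u.1 u.2) u.2)) (drop (cut u.1 u.2) u.2).

Lemma cut_measurable h : discretely_measurable (cut ^~ h).
Proof.
apply: discretely_measurable_find => k.
exact: (discretely_measurable_comp (fun p => ~~ isSome p) (turn_discretely_measurable pi _)).
Qed.

Lemma class_cut_measurable (L : Type) (F : K -> nat -> L) h :
  discretely_measurable (fun r => F (c r (take (cut r h) h)) (cut r h)).
Proof.
apply: (discretely_measurable_bind (F := fun n r => F (c r (take n h)) n)).
  exact: cut_measurable.
by move=> n; apply: (discretely_measurable_comp (F ^~ n)); exact: c_measurable.
Qed.

Lemma cut_le_measurable h : discretely_measurable (fun r => (cut r h <= size h)%N).
Proof. exact: (discretely_measurable_comp (fun n => (n <= size h)%N) (cut_measurable h)). Qed.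

Lemma ext_turn_measurable h : fiber_measurable (ext_turn ^~ h).
Proof.
apply: discretely_measurable_fiber; apply: discretely_measurable_if.
- exact: cut_le_measurable.
- exact: (discretely_measurable_comp (fun n => if (size h - n < N)%N
    then Some (sched (size h - n)) else None) (cut_measurable h)).
- exact: turn_discretely_measurable.
Qed.

Lemma ext_bitA_measurable x h : fiber_measurable (ext_bitA x ^~ h).
Proof.
apply: discretely_measurable_fiber; apply: discretely_measurable_if.
- exact: discretely_measurableT_comp measurable_fst (cut_le_measurable h).
- exact: discretely_measurableT_comp measurable_fst
    (class_cut_measurable (fun k n => mA k x (drop n h)) h).
- exact: bitA_discretely_measurable.
Qed.

Lemma ext_bitB_measurable y h : fiber_measurable (ext_bitB y ^~ h).
Proof.
apply: discretely_measurable_fiber; apply: discretely_measurable_if.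
- exact: discretely_measurableT_comp measurable_fst (cut_le_measurable h).
- exact: discretely_measurableT_comp measurable_fst
    (class_cut_measurable (fun k n => mB k y (drop n h)) h).
- exact: bitB_discretely_measurable.
Qed.

Lemma ext_output_measurable h : fiber_measurable (fun r => ext_output (r, h)).
Proof.
apply: discretely_measurable_fiber.
exact: (class_cut_measurable (fun k n => o k (drop n h)) h).
Qed.

Lemma cut_le r h n : (n <= size h)%N -> turn r (take n h) = None -> (cut r h <= n)%N.
Proof.
move=> nh tn; rewrite leqNgt; apply/negP => lt.
by have := before_find 0%N lt; rewrite nth_iota// add0n tn.
Qed.

Lemma ext_turn_bounded r h : (max_bits pi + N <= size h)%N -> ext_turn r h = None.
Proof.
move=> hM; have Mh : (max_bits pi <= size h)%N by exact: leq_trans (leq_addr _ _) hM.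
have cM : (cut r h <= max_bits pi)%N.
  by apply: cut_le => //; rewrite turn_bounded// size_takel.
rewrite /ext_turn (leq_trans cM Mh) ltnNge.
by rewrite leq_subRL ?(leq_trans cM Mh)// (leq_trans _ hM)// leq_add2r.
Qed.

(** The random strings are those of [pi], so events of both protocols live on one probability
    space. *)
Definition ext : protocol R X Y Z :=
  Protocol (pub_law pi) (privA_law pi) (privB_law pi)
    ext_turn_measurable ext_bitA_measurable ext_bitB_measurable
    ext_output_measurable ext_turn_bounded.

(** The search fails on a proper prefix of a complete transcript, and [find] then returns the length
    of the searched list. *)
Lemma cut_take r h k : ended r h -> (k < size h)%N -> cut r (take k h) = k.+1.
Proof.
move=> /andP[_ /allP hs] kh; rewrite /cut size_takel ?(ltnW kh)//.
rewrite -[RHS](size_iota 0); apply/eqP; rewrite eqn_leq find_size leqNgt -has_find.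
apply/hasPn => i; rewrite mem_iota add0n ltnS => ik.
rewrite take_takel// negbK hs// mem_iota add0n.
exact: leq_ltn_trans kh.
Qed.

Lemma cut_cat r h e : ended r h -> cut r (h ++ e) = size h.
Proof.
move=> /andP[hn /allP hs]; apply/eqP; rewrite eqn_leq cut_le/=.
- rewrite leqNgt; apply/negP => lt.
  have hasP : has (fun k => ~~ isSome (turn r (take k (h ++ e)))) (iota 0 (size (h ++ e)).+1).
    by rewrite has_find size_iota (leq_trans lt)// ltnW// ltnS size_cat leq_addr.
  have := nth_find 0%N hasP; rewrite -/(cut r (h ++ e)) nth_iota; last first.
    by rewrite (leq_trans lt)// ltnW// ltnS size_cat leq_addr.
  by rewrite add0n takel_cat ?(ltnW lt)// hs// mem_iota.
- by rewrite size_cat leq_addr.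
- by rewrite take_size_cat//; case: (turn r h) hn.
Qed.

(** Closed form of the appended bits. The hypothesis [bitE] says that the scheduled party can
    compute the next one from the class, his own input and the earlier appended bits. *)
Variable bit : K -> X -> Y -> nat -> bool.
Hypothesis bitE : forall k x y i, (i < N)%N ->
  match sched i with
  | Alice => mA k x (mkseq (bit k x y) i)
  | Bob => mB k y (mkseq (bit k x y) i)
  end = bit k x y i.

(** By [final_eqE] for the extension it suffices to check the claimed string: positions inside the
    old transcript repeat the checks of [pi], later ones follow from [bitE]. *)
Lemma ext_final x y (w : randomness pi) :
  @final _ _ _ _ ext x y w =
  final x y w ++ mkseq (bit (c w.1.1 (final x y w)) x y) N.
Proof.
have he := ended_final x y w; have := eqxx (final x y w); rewrite {1}final_eqE.
set h := final x y w in he *; set k := c _ _; set e := mkseq _ _.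
move=> /and3P[_ /allP ha /allP hb].
have /andP[_ /allP hs] := he.
have se : size e = N by rewrite size_mkseq.
have te i : (i <= N)%N -> take i e = mkseq (bit k x y) i.
  by move=> iN; rewrite /e /mkseq -map_take take_iota (minn_idPl iN).
have early i : (i < size h)%N -> take i (h ++ e) = take i h /\
    (cut w.1.1 (take i h) <= size (take i h))%N = false.
  move=> ih; rewrite takel_cat ?(ltnW ih)//; split=> //.
  by rewrite cut_take// size_takel ?(ltnW ih)// ltnn.
have late i : (i <= N)%N -> take (size h + i) (h ++ e) = h ++ mkseq (bit k x y) i /\
    cut w.1.1 (h ++ mkseq (bit k x y) i) = size h.
  by move=> iN; rewrite take_cat ltnNge leq_addr addKn /= te// cut_cat.
have step (Q : nat -> Prop) : (forall i, (i < size h)%N -> Q i) ->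
    (forall i, (i < N)%N -> Q (size h + i)%N) ->
    forall i, i \in iota 0 (size (h ++ e)) -> Q i.
  move=> q1 q2 i; rewrite mem_iota add0n size_cat se => iN.
  have [ih|hi] := ltnP i (size h); first exact: q1.
  by rewrite -(subnKC hi); apply: q2; rewrite -(ltn_add2l (size h)) subnKC.
apply/eqP; rewrite final_eqE; apply/and3P; split.
- apply/andP; split.
    have [_ cN] := late N (leqnn _).
    rewrite /= /ext_turn -/e in cN *.
    by rewrite cN size_cat leq_addr addKn se ltnn.
  apply/allP; apply: step => i iN /=; rewrite /ext_turn.
    by have [-> ->] := early i iN; apply: hs; rewrite mem_iota.
  have [-> ->] := late i (ltnW iN).
  by rewrite size_cat leq_addr addKn size_mkseq iN.
- apply/allP; apply: step => i iN /=; rewrite /ext_turn /ext_bitA /=.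
    have [-> ->] := early i iN; rewrite nth_cat iN.
    by have := ha i; rewrite mem_iota => /(_ iN).
  have [-> ->] := late i (ltnW iN).
  rewrite size_cat leq_addr addKn size_mkseq iN.
  rewrite take_size_cat// drop_size_cat// nth_cat ltnNge leq_addr addKn/=.
  have := @bitE k x y i iN; rewrite nth_mkseq//.
  by case: (sched i) => // ->.
- apply/allP; apply: step => i iN /=; rewrite /ext_turn /ext_bitB /=.
    have [-> ->] := early i iN; rewrite nth_cat iN.
    by have := hb i; rewrite mem_iota => /(_ iN).
  have [-> ->] := late i (ltnW iN).
  rewrite size_cat leq_addr addKn size_mkseq iN.
  rewrite take_size_cat// drop_size_cat// nth_cat ltnNge leq_addr addKn/=.
  have := @bitE k x y i iN; rewrite nth_mkseq//.
  by case: (sched i) => // ->.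
Qed.

Lemma ext_result x y (w : randomness pi) :
  @result _ _ _ _ ext x y w =
  o (c w.1.1 (final x y w)) (mkseq (bit (c w.1.1 (final x y w)) x y) N).
Proof.
rewrite /result /transcript -/(final x y (w : randomness ext)) ext_final /=.
rewrite /ext_output /= cut_cat; last exact: ended_final.
by rewrite take_size_cat// drop_size_cat.
Qed.

End Extension.

(** * Joint law of a quantized transcript and the inputs *)

Lemma sum_triple (R : realType) (A X Y : finType) (g : A * X * Y -> R) :
  \sum_w g w = \sum_x \sum_y \sum_i g (i, x, y).
Proof.
rewrite [RHS](eq_bigr (fun x => \sum_i \sum_y g (i, x, y))); last first.
  by move=> x _; rewrite exchange_big.
rewrite exchange_big/= (pair_bigA _ (fun i x => \sum_y g (i, x, y)))/=.
rewrite (pair_bigA _ (fun ix y => g (ix.1, ix.2, y)))/=.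
by apply: eq_bigr => -[[i x] y] _.
Qed.

Lemma sum_fiber_triple (R : realType) (A B X Y : finType) (g : A * X * Y -> R)
    (F : A * X * Y -> B) k x y :
  \sum_(w | (F w, w.1.2, w.2) == (k, x, y)) g w =
  \sum_(i | F (i, x, y) == k) g (i, x, y).
Proof.
rewrite (reindex_onto (fun i => (i, x, y)) (fun w => w.1.1)) /=.
  by apply: eq_bigl => i; rewrite !xpair_eqE !eqxx !andbT.
by move=> [[i x'] y'] /=; rewrite !xpair_eqE => /andP[/andP[_ /eqP ->] /eqP ->].
Qed.

Section JointLaw.
Variables (R : realType) (X Y Z : finType) (pi : protocol R X Y Z).
Variables (mu : X * Y -> R) (mu_pmf : is_pmf mu).
Variables (m : nat) (q : pub pi * seq bool -> 'I_m) (qq : quantizer q).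

Let q_measurable h : discretely_measurable (fun r => q (r, h)).
Proof. exact: fiber_discretely_measurable (qq h). Qed.

Lemma quantized_measurable x y : discretely_measurable
  (fun w : pub pi * privA pi * privB pi => q (w.1.1, final x y w)).
Proof. exact: (transcript_measurable x y q_measurable). Qed.

Lemma joint_lawE i x y : joint_law mu q (i, x, y) =
  mu (x, y) * prob (law pi) [set w | q (w.1.1, final x y w) = i].
Proof. by []. Qed.

Lemma joint_law_ge0 u : 0 <= joint_law mu q u.
Proof.
by case: u => [[i x] y]; rewrite joint_lawE mulr_ge0 ?prob_ge0//; case: mu_pmf.
Qed.

Lemma sum_joint_law : \sum_u joint_law mu q u = 1.
Proof.
rewrite sum_triple; case: mu_pmf => _ <-.
rewrite (pair_bigA _ (fun x y => \sum_i joint_law mu q (i, x, y)))/=.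
apply: eq_bigr => -[x y] _ /=.
under eq_bigr do rewrite joint_lawE.
by rewrite -mulr_sumr sum_prob1 ?mulr1//; exact: quantized_measurable.
Qed.

Lemma sum_joint_law_event (b : 'I_m -> X -> Y -> bool) :
  \sum_(w | b w.1.1 w.1.2 w.2) joint_law mu q w =
  \sum_x \sum_y mu (x, y) * event_prob (fun r h => b (q (r, h)) x y) x y.
Proof.
rewrite big_mkcond sum_triple; apply: eq_bigr => x _; apply: eq_bigr => y _ /=.
rewrite -big_mkcond /= /event_prob.
rewrite (prob_partition_fin _ (fun i => b i x y) (quantized_measurable x y)).
by rewrite mulr_sumr.
Qed.

End JointLaw.

(** * Information cost of the appended rounds *)

Section ExtensionInformation.
Variables (R : realType) (X Y Z : finType) (pi : protocol R X Y Z).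
Variables (K : finType) (c : pub pi -> seq bool -> K).
Hypothesis c_measurable : forall h, discretely_measurable (c ^~ h).
Variables (N : nat) (sched : nat -> party).
Variables (mA : K -> X -> seq bool -> bool) (mB : K -> Y -> seq bool -> bool).
Variable o : K -> seq bool -> Z.
Variable bit : K -> X -> Y -> nat -> bool.
Hypothesis bitE : forall k x y i, (i < N)%N ->
  match sched i with
  | Alice => mA k x (mkseq (bit k x y) i)
  | Bob => mB k y (mkseq (bit k x y) i)
  end = bit k x y i.
Variables (mu : X * Y -> R) (mu_pmf : is_pmf mu).

Local Notation pi' := (ext c_measurable N sched mA mB o).

Definition bits k x y : N.-tuple bool := Tuple (introT eqP (size_mkseq (bit k x y) N)).

(** The quantizer [q] records the class of the old transcript [t] and the whole table
    [e -> q' (t ++ e)]. This is finite data, and together with the inputs it determines the value of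
    [q'] on the extended transcript. *)
Lemma quantizer_restrict n (q' : pub pi' * seq bool -> 'I_n) : quantizer (pi := pi') q' ->
  exists m (q : pub pi * seq bool -> 'I_m) (cl : 'I_m -> K)
    (G : 'I_m -> N.-tuple bool -> 'I_n),
  [/\ quantizer q, forall r h, cl (q (r, h)) = c r h &
    forall i x y, joint_law mu q' (i, x, y) =
      \sum_(w : 'I_m * X * Y |
         (G w.1.1 (bits (cl w.1.1) w.1.2 w.2), w.1.2, w.2) == (i, x, y))
        joint_law mu q w].
Proof.
move=> qq'.
pose Kq : finType := ({ffun N.-tuple bool -> 'I_n} * K)%type.
pose qK (u : pub pi * seq bool) : Kq :=
  ([ffun e : N.-tuple bool => q' (u.1, u.2 ++ e)], c u.1 u.2).
pose q u := enum_rank (qK u).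
have mq h : discretely_measurable (fun r => q (r, h)).
  apply: (discretely_measurable_comp enum_rank (g := fun r => qK (r, h))).
  apply: discretely_measurable_pair; last exact: c_measurable.
  apply: discretely_measurable_ffun => e.
  exact: fiber_discretely_measurable (qq' (h ++ e)).
have qq : quantizer q by move=> h; exact: discretely_measurable_fiber (mq h).
pose cl (i : 'I_#|Kq|) : K := (enum_val i : Kq).2.
pose G (i : 'I_#|Kq|) (e : N.-tuple bool) := (enum_val i : Kq).1 e.
exists #|Kq|, q, cl, G; split=> //.
  by move=> r h; rewrite /cl enum_rankK.
move=> i x y.
rewrite (sum_fiber_triple _ (fun w => G w.1.1 (bits (cl w.1.1) w.1.2 w.2))) /=.
under eq_bigr do rewrite joint_lawE.
rewrite -mulr_sumr; congr (_ * _).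
rewrite -(prob_partition_fin _ (fun k => G k (bits (cl k) x y) == i)
  (quantized_measurable qq x y)).
rewrite /prob /=; congr (fine _).
rewrite /randomness_law /=; congr (product_measure1 _ _ _).
apply/seteqP; split=> w /=; rewrite /transcript -/(final x y (w : randomness pi'))
  (ext_final c_measurable o bitE) /G /cl enum_rankK ffunE /=.
  by move=> <-.
by move=> /eqP.
Qed.

(** Given the class and [y], the bits [b] determine all appended bits. Each has probability at most
    [s], hence entropy at most [hhat s], so [rv_cmi_bits] bounds the increase for every
    quantizer. *)
Lemma info_X_given_Y_ext (J : finType) (b : J -> K -> X -> Y -> bool) (s : R) :
  (forall j, \sum_x \sum_y mu (x, y) *
     event_prob (fun r h => b j (c r h) x y) x y <= s) ->
  (forall k x x' y, (forall j, b j k x y = b j k x' y) ->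
     mkseq (bit k x y) N = mkseq (bit k x' y) N) ->
  (info_X_given_Y mu pi' <= info_X_given_Y mu pi + (#|J|%:R * hhat s)%:E)%E.
Proof.
move=> bs det; apply: ub_ereal_sup => _ [n [q' [/quantizer_restrict[m [q [cl [G [qq clE lawE]]]]] ->]]].
have P0 := joint_law_ge0 mu_pmf q; have P1 := sum_joint_law mu_pmf qq.
set P := joint_law mu q in P0 P1.
pose F (w : 'I_m * X * Y) := G w.1.1 (bits (cl w.1.1) w.1.2 w.2).
rewrite (_ : joint_law mu q' = fun u => \sum_(w | (F w, w.1.2, w.2) == u) P w); last first.
  by apply/funext => -[[i x] y]; exact: lawE.
rewrite (cond_mutual_infoE P0).
apply: (@le_trans _ _ (rv_cmi P (fun w => w.1.1) (fun w => w.1.2) (fun w => w.2)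
    + (size (enum J))%:R * hhat s)%:E).
  rewrite lee_fin.
  apply: (rv_cmi_bits P0 P1 _ (b := fun j w => b j (cl w.1.1) w.1.2 w.2)) => [j|].
    apply: (rv_entropy_bool_le P0 P1); apply: le_trans (bs j).
    rewrite /P (sum_joint_law_event mu qq (fun i x y => b j (cl i) x y)).
    apply: ler_sum => x _; apply: ler_sum => y _.
    have -> // : (fun r h => b j (cl (q (r, h))) x y) = (fun r h => b j (c r h) x y).
    by apply/funext => r; apply/funext => h; rewrite clE.
  move=> [[i x] y] [[i' x'] y'] /= [<- <-] /eq_in_map e.
  rewrite /F /=; congr G; apply: val_inj; apply: det => j.
  by rewrite e// mem_enum.
(* The restricted [q] is itself a quantizer for [pi], so its information is below the supremum. *)
rewrite -cardE EFinD leeD2r//; apply: ereal_sup_ubound; exists m, q; split=> //.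
rewrite -(cond_mutual_infoE P0); congr (cond_mutual_info _)%:E.
by apply/funext => u; rewrite (big_pred1 u)// => -[[i x] y].
Qed.

(** The same argument with the two input coordinates exchanged. *)
Lemma info_Y_given_X_ext (J : finType) (b : J -> K -> X -> Y -> bool) (s : R) :
  (forall j, \sum_x \sum_y mu (x, y) *
     event_prob (fun r h => b j (c r h) x y) x y <= s) ->
  (forall k x y y', (forall j, b j k x y = b j k x y') ->
     mkseq (bit k x y) N = mkseq (bit k x y') N) ->
  (info_Y_given_X mu pi' <= info_Y_given_X mu pi + (#|J|%:R * hhat s)%:E)%E.
Proof.
move=> bs det; apply: ub_ereal_sup => _ [n [q' [/quantizer_restrict[m [q [cl [G [qq clE lawE]]]]] ->]]].
have P0 := joint_law_ge0 mu_pmf q; have P1 := sum_joint_law mu_pmf qq.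
set P := joint_law mu q in P0 P1.
pose F (w : 'I_m * X * Y) := G w.1.1 (bits (cl w.1.1) w.1.2 w.2).
rewrite (_ : (fun u => _) = fun u => \sum_(w | (F w, w.2, w.1.2) == u) P w); last first.
  apply/funext => -[[i y] x] /=; rewrite lawE; apply: eq_bigl => w.
  by rewrite !xpair_eqE andbAC.
rewrite (cond_mutual_infoE P0).
apply: (@le_trans _ _ (rv_cmi P (fun w => w.1.1) (fun w => w.2) (fun w => w.1.2)
    + (size (enum J))%:R * hhat s)%:E).
  rewrite lee_fin.
  apply: (rv_cmi_bits P0 P1 _ (b := fun j w => b j (cl w.1.1) w.1.2 w.2)) => [j|].
    apply: (rv_entropy_bool_le P0 P1); apply: le_trans (bs j).
    rewrite /P (sum_joint_law_event mu qq (fun i x y => b j (cl i) x y)).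
    apply: ler_sum => x _; apply: ler_sum => y _.
    have -> // : (fun r h => b j (cl (q (r, h))) x y) = (fun r h => b j (c r h) x y).
    by apply/funext => r; apply/funext => h; rewrite clE.
  move=> [[i x] y] [[i' x'] y'] /= [<- <-] /eq_in_map e.
  rewrite /F /=; congr G; apply: val_inj; apply: det => j.
  by rewrite e// mem_enum.
rewrite -cardE EFinD leeD2r//; apply: ereal_sup_ubound; exists m, q; split=> //.
rewrite -(cond_mutual_infoE P0); congr (cond_mutual_info _)%:E.
apply/funext => -[[i y] x] /=; rewrite (big_pred1 (i, x, y))// => -[[i' x'] y'] /=.
by rewrite !xpair_eqE andbAC.
Qed.

End ExtensionInformation.

(** * The verification rounds and their cost *)

Section Verification.
Variables (R : realType) (X Y Z : finType) (f : X -> Y -> Z).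
Variables (mu : X * Y -> R) (mu_pmf : is_pmf mu).
Variables (pi : protocol R X Y Z) (eps : R) (u0 : X * Y).
Hypotheses (eps_gt0 : 0 < eps) (eps_le1 : eps <= 1) (pi_f : performs f eps pi).

Let s := Num.sqrt eps.

Let s_gt0 : 0 < s. Proof. by rewrite sqrtr_gt0. Qed.

Let ss : s * s = eps. Proof. by rewrite -expr2 sqr_sqrtr// ltW. Qed.

Let eps_le_s : eps <= s.
Proof.
have s1 : s <= 1 by rewrite -sqrtr1 ler_wsqrtr.
by rewrite -ss ler_piMl// ltW.
Qed.

Let mu_ge0 u : 0 <= mu u. Proof. by case: mu_pmf. Qed.

Let mu_sum : \sum_x \sum_y mu (x, y) = 1.
Proof.
case: mu_pmf => _ <-; rewrite (pair_bigA _ (fun x y => mu (x, y)))/=.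
by apply: eq_bigr => -[].
Qed.

Lemma pmf_row_le1 x : \sum_y mu (x, y) <= 1.
Proof.
by rewrite -mu_sum [leRHS](bigD1 x)//= lerDl; apply: sumr_ge0 => ? _; apply: sumr_ge0.
Qed.

Lemma pmf_col_le1 y : \sum_x mu (x, y) <= 1.
Proof.
by rewrite -mu_sum exchange_big [leRHS](bigD1 y)//= lerDl; apply: sumr_ge0 => ? _; apply: sumr_ge0.
Qed.

Lemma pmf_le1 u : mu u <= 1.
Proof.
case: u => x y; apply: le_trans (pmf_row_le1 x).
by rewrite (bigD1 y)//= lerDl sumr_ge0.
Qed.

(* [None]: nothing to check for [u]; [Some true]: Alice speaks first;
   [Some false]: Bob speaks first. *)
Definition suspect (u : X * Y) (r : pub pi) (h : seq bool) : option bool :=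
  if output (r, h) == f u.1 u.2 then None
  else Some (s * (\sum_y mu (u.1, y) * bob_prob y h r) <= bob_prob u.2 h r).

(** All that the verification reads off a transcript, as an element of a finite type. *)
Definition transcript_class (r : pub pi) (h : seq bool) : Z * {ffun X * Y -> option bool} :=
  (output (r, h), [ffun u => suspect u r h]).

Lemma suspect_measurable u h : discretely_measurable (suspect u ^~ h).
Proof.
apply: discretely_measurable_if; last first.
- apply: (discretely_measurable_comp Some); apply: measurable_pred_discrete.
  rewrite -[X in measurable X]setTI; apply: measurable_fun_le => //.
    apply: measurable_funM => //; apply: measurable_sum => y.
    by apply: measurable_funM => //; exact: measurable_bob_prob.
  exact: measurable_bob_prob.
- exact: discretely_measurable_cst.
- apply: (discretely_measurable_comp (fun z => z == f u.1 u.2)).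
  by apply: fiber_discretely_measurable; exact: output_measurable.
Qed.

Lemma transcript_class_measurable h : discretely_measurable (transcript_class ^~ h).
Proof.
apply: discretely_measurable_pair.
  by apply: fiber_discretely_measurable; exact: output_measurable.
by apply: discretely_measurable_ffun => u; exact: suspect_measurable.
Qed.

Lemma suspected_measurable u a h :
  discretely_measurable (fun r => suspect u r h == Some a).
Proof. exact: (discretely_measurable_comp (fun v => v == Some a) (suspect_measurable u h)). Qed.

Definition suspicion_prob u a := @event_prob _ _ _ _ pi (fun r h => suspect u r h == Some a).

(** On input [u] itself, a transcript that makes [u] suspect is an error of [pi]. *)
Lemma suspicion_prob_le_eps u a : suspicion_prob u a u.1 u.2 <= eps.
Proof.
have mres : discretely_measurable (fun w : pub pi * privA pi * privB pi => result u.1 u.2 w).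
  apply: (transcript_measurable u.1 u.2 (F := fun r h => output (r, h))) => h.
  by apply: fiber_discretely_measurable; exact: output_measurable.
have mbad : measurable [set w : pub pi * privA pi * privB pi | result u.1 u.2 w <> f u.1 u.2].
  exact: (mres [set z | z <> f u.1 u.2]).
apply: (@le_trans _ _ (prob (law pi) [set w | result u.1 u.2 w <> f u.1 u.2])).
  apply: le_prob => //.
    exact: (transcript_measurable u.1 u.2 (suspected_measurable u a) [set true]).
  move=> w /=; rewrite /suspect /result /transcript -/(final u.1 u.2 w).
  by case: ifPn => [_ /eqP|/eqP].
by rewrite -lee_fin probE//; exact: pi_f.
Qed.

(** When Alice speaks first, [s] times the [mu]-weighted sum of [bob_prob] is at most
    [bob_prob u.2]. Hence [s] times the left side is at most an error probability on input [u], thus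
    at most [eps = s * s]. *)
Lemma suspicion_prob_alice u :
  \sum_y mu (u.1, y) * suspicion_prob u true u.1 y <= s.
Proof.
rewrite -(ler_pM2l s_gt0) ss; apply: le_trans (suspicion_prob_le_eps u true).
rewrite [leRHS](_ : _ = \sum_y (y == u.2)%:R * suspicion_prob u true u.1 y); last first.
  by rewrite (big_only1 u.2)//= ?eqxx ?mul1r// => y /negbTE ->; rewrite mul0r.
rewrite mulr_sumr; under eq_bigr do rewrite mulrA.
apply: event_prob_le => [h|y|y|r h].
- exact: suspected_measurable.
- by rewrite mulr_ge0// ltW.
- exact: ler0n.
- rewrite /suspect; case: ifP => // _ /eqP[le].
  under eq_bigr do rewrite -mulrA.
  rewrite -mulr_sumr (le_trans le)// [leRHS](big_only1 u.2)//= ?eqxx ?mul1r//.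
  by move=> y /negbTE ->; rewrite mul0r.
Qed.

(** For every input [x] of Alice, the test defining [suspect], with weights always from the row of
    [u.1], bounds the probability by [s] times a sum of at most 1. Averaging over [x] keeps the
    bound. *)
Lemma suspicion_prob_bob u :
  \sum_x mu (x, u.2) * suspicion_prob u false x u.2 <= s.
Proof.
have le x : suspicion_prob u false x u.2 <= s.
  rewrite [leLHS](_ : _ = \sum_y (y == u.2)%:R * suspicion_prob u false x y); last first.
    by rewrite (big_only1 u.2)//= ?eqxx ?mul1r// => y /negbTE ->; rewrite mul0r.
  apply: (@le_trans _ _ (\sum_y s * mu (u.1, y) * suspicion_prob u false x y)).
    apply: event_prob_le => [h|y|y|r h].
    - exact: suspected_measurable.
    - exact: ler0n.
    - by rewrite mulr_ge0// ltW.
    - rewrite /suspect; case: ifP => // _ /eqP[/negbT]; rewrite -ltNge => /ltW le.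
      rewrite (big_only1 u.2)//= ?eqxx ?mul1r//; last first.
        by move=> y /negbTE ->; rewrite mul0r.
      by under eq_bigr do rewrite -mulrA; rewrite -mulr_sumr.
  under eq_bigr do rewrite -mulrA; rewrite -mulr_sumr ler_piMr ?(ltW s_gt0)//.
  apply: le_trans (pmf_row_le1 u.1); apply: ler_sum => y _; rewrite ler_piMr//.
  by apply: event_prob_le1 => h; exact: suspected_measurable.
apply: (@le_trans _ _ (\sum_x mu (x, u.2) * s)).
  by apply: ler_sum => x _; rewrite ler_wpM2l.
by rewrite -mulr_suml ler_piMl ?(ltW s_gt0)// pmf_col_le1.
Qed.

(** Slots 0 and 1 are Alice's opening bit and Bob's reply, slots 2 and 3 Bob's opening bit and
    Alice's reply. All four are always sent, those of the wrong order being false, which keeps the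
    schedule fixed. *)
Definition flag (k : Z * {ffun X * Y -> option bool}) x y (u : X * Y) (slot : nat) : bool :=
  match slot with
  | 0 => (x == u.1) && (k.2 u == Some true)
  | 1 => ((x == u.1) && (k.2 u == Some true)) && (y == u.2)
  | 2 => (y == u.2) && (k.2 u == Some false)
  | _ => ((y == u.2) && (k.2 u == Some false)) && (x == u.1)
  end.

Lemma event_prob_cond (p : bool) (D : pub pi -> seq bool -> bool) x y :
  event_prob (fun r h => p && D r h) x y = p%:R * event_prob D x y.
Proof.
case: p => /=; rewrite ?mul1r// mul0r /event_prob.
by rewrite (_ : [set _ | _] = set0) /prob ?measure0// -subset0.
Qed.

(** Opening bits are covered by the two suspicion bounds. A positive reply forces the input to be
    [u], which costs at most [eps <= s]. *)
Lemma flag_prob u slot :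
  \sum_x \sum_y mu (x, y) *
    event_prob (fun r h => flag (transcript_class r h) x y u slot) x y <= s.
Proof.
have single a : mu u * suspicion_prob u a u.1 u.2 <= s.
  rewrite (le_trans _ eps_le_s)// (le_trans _ (suspicion_prob_le_eps u a))//.
  by rewrite ler_piMl ?event_prob_ge0// pmf_le1.
have evE (F : X -> Y -> bool) a sl :
    (forall k x y, flag k x y u sl = F x y && (k.2 u == Some a)) ->
    \sum_x \sum_y mu (x, y) *
      event_prob (fun r h => flag (transcript_class r h) x y u sl) x y =
    \sum_x \sum_y mu (x, y) * ((F x y)%:R * suspicion_prob u a x y).
  move=> e; apply: eq_bigr => x _; apply: eq_bigr => y _.
  rewrite -event_prob_cond.
  have -> // : (fun r h => flag (transcript_class r h) x y u sl) =
      (fun r h => F x y && (suspect u r h == Some a)).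
  by apply/funext => r; apply/funext => h; rewrite e ffunE.
have onlyu a : \sum_x \sum_y mu (x, y) *
    (((x == u.1) && (y == u.2))%:R * suspicion_prob u a x y) =
    mu u * suspicion_prob u a u.1 u.2.
  rewrite (big_only1 u.1)//=; last first.
    by move=> x /negbTE n _; apply: big1 => y _; rewrite n mul0r mulr0.
  rewrite (big_only1 u.2)//=; last by move=> y /negbTE n _; rewrite n andbF mul0r mulr0.
  by rewrite !eqxx mul1r -surjective_pairing.
case: slot => [|[|[|slot]]].
- rewrite (evE (fun x _ => x == u.1) true)//.
  rewrite (big_only1 u.1)//=; last first.
    by move=> x /negbTE n _; apply: big1 => y _; rewrite n mul0r mulr0.
  by under eq_bigr do rewrite eqxx mul1r; exact: suspicion_prob_alice.
- rewrite (evE (fun x y => (x == u.1) && (y == u.2)) true) ?onlyu//.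
  by move=> k x y; rewrite /flag andbAC.
- rewrite (evE (fun _ y => y == u.2) false)// exchange_big.
  rewrite (big_only1 u.2)//=; last first.
    by move=> y /negbTE n _; apply: big1 => x _; rewrite n mul0r mulr0.
  by under eq_bigr do rewrite eqxx mul1r; exact: suspicion_prob_bob.
- rewrite (evE (fun x y => (x == u.1) && (y == u.2)) false) ?onlyu//.
  by move=> k x y; rewrite /flag andbC andbA.
Qed.

Definition pair_nth (i : nat) : X * Y := nth u0 (enum {: X * Y}) i.

Definition check_bit k x y (i : nat) : bool := flag k x y (pair_nth (i %/ 4)%N) (i %% 4)%N.

Definition check_sched (i : nat) : party :=
  match (i %% 4)%N with 0 | 3 => Alice | _ => Bob end.

(** In a reply round the last bit exchanged is the other party's opening bit for the same pair. *)
Definition check_bitA (k : Z * {ffun X * Y -> option bool}) (x : X) (e : seq bool) :=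
  let u := pair_nth (size e %/ 4)%N in
  match (size e %% 4)%N with
  | 0 => (x == u.1) && (k.2 u == Some true)
  | _ => last false e && (x == u.1)
  end.

Definition check_bitB (k : Z * {ffun X * Y -> option bool}) (y : Y) (e : seq bool) :=
  let u := pair_nth (size e %/ 4)%N in
  match (size e %% 4)%N with
  | 1 => last false e && (y == u.2)
  | _ => (y == u.2) && (k.2 u == Some false)
  end.

(** Offsets 1 and 3 are the two replies, either of which confirms [u]; otherwise the output of [pi]
    stands. *)
Definition check_output (k : Z * {ffun X * Y -> option bool}) (e : seq bool) : Z :=
  if [pick u | nth false e (index u (enum {: X * Y}) * 4 + 1)%N ||
               nth false e (index u (enum {: X * Y}) * 4 + 3)%N] is Some u
  then f u.1 u.2 else k.1.

Local Notation N := (#|{: X * Y}| * 4)%N.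

Lemma check_bitE k x y i : (i < N)%N ->
  match check_sched i with
  | Alice => check_bitA k x (mkseq (check_bit k x y) i)
  | Bob => check_bitB k y (mkseq (check_bit k x y) i)
  end = check_bit k x y i.
Proof.
move=> _; rewrite /check_sched /check_bitA /check_bitB size_mkseq.
rewrite [RHS]/check_bit.
have last_mkseq j : last false (mkseq (check_bit k x y) j.+1) = check_bit k x y j.
  by rewrite -nth_last size_mkseq nth_mkseq.
rewrite (divn_eq i 4); have := ltn_pmod i (isT : 0 < 4)%N.
move: (i %/ 4)%N (i %% 4)%N => q r r4.
have dm r' : (r' < 4)%N -> ((q * 4 + r') %/ 4 = q)%N * ((q * 4 + r') %% 4 = r')%N.
  by move=> ?; rewrite divnMDl// divn_small// addn0 modnMDl modn_small.
rewrite (dm r r4).2 (dm r r4).1.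
case: r r4 => [|[|[|[|//]]]] _ //=.
- by rewrite addn1 last_mkseq /check_bit -[(q * 4)%N]addn0 (dm 0%N isT).1 (dm 0%N isT).2.
- by rewrite addnS last_mkseq /check_bit (dm 2%N isT).1 (dm 2%N isT).2.
Qed.

Definition checked : protocol R X Y Z :=
  ext transcript_class_measurable N check_sched check_bitA check_bitB check_output.

(** A confirmed pair is the actual input. If nothing is confirmed, then in particular [(x, y)] is
    not suspect, so the output of [pi] is already right. *)
Lemma checked_result x y (w : randomness pi) : @result _ _ _ _ checked x y w = f x y.
Proof.
rewrite (ext_result transcript_class_measurable check_output check_bitE).
set h := final x y w; set k := transcript_class _ _.
have flagE u slot : (slot < 4)%N ->
    nth false (mkseq (check_bit k x y) N) (index u (enum {: X * Y}) * 4 + slot)%N =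
    flag k x y u slot.
  move=> sl; have iu : (index u (enum {: X * Y}) < #|{: X * Y}|)%N.
    by rewrite cardE index_mem mem_enum.
  rewrite nth_mkseq; last first.
    apply: (@leq_trans ((index u (enum {: X * Y})).+1 * 4)%N).
      by rewrite mulSn addnC ltn_add2r.
    by rewrite leq_mul2r iu orbT.
  rewrite /check_bit divnMDl// divn_small// addn0 modnMDl modn_small//.
  by rewrite /pair_nth nth_index// mem_enum.
rewrite /check_output; case: pickP => [u|none].
  rewrite !flagE//= => /orP[/andP[/andP[/eqP -> _] /eqP ->]//|/andP[/andP[/eqP -> _] /eqP ->]//].
have := none (x, y); rewrite !flagE//= !eqxx andbT /= ffunE /suspect /=.
case: ifPn => [/eqP -> //|_]; by case: (_ <= _).
Qed.

Lemma checked_performs : performs f 0 checked.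
Proof.
move=> x y; rewrite (_ : [set w | _] = set0); last first.
  by rewrite -subset0 => w; apply; exact: checked_result.
by have -> : randomness_law (set0 : set (randomness checked)) = 0%E by exact: (measure0 (law pi)).
Qed.

(** Given [y], Alice's slots 0 and 3 determine the other two; given [x], Bob's slots 1 and 2 do.
    Each information term thus grows by two bits per pair, which [J] indexes. *)
Lemma checked_IC : (protocol_IC mu checked <=
  protocol_IC mu pi + (4 * #|X|%:R * #|Y|%:R * hhat s)%:E)%E.
Proof.
pose J : finType := (bool * (X * Y))%type.
have mE (k : Z * {ffun X * Y -> option bool}) x y x' y' :
    (forall u slot, flag k x y u slot = flag k x' y' u slot) ->
    mkseq (check_bit k x y) N = mkseq (check_bit k x' y') N.
  by move=> e; apply: eq_mkseq => i; exact: e.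
have hX := info_X_given_Y_ext transcript_class_measurable check_output check_bitE mu_pmf
  (b := fun (j : J) k x y => flag k x y j.2 (if j.1 then 0 else 3)%N)
  (fun j => flag_prob j.2 _).
have hY := info_Y_given_X_ext transcript_class_measurable check_output check_bitE mu_pmf
  (b := fun (j : J) k x y => flag k x y j.2 (if j.1 then 1 else 2)%N)
  (fun j => flag_prob j.2 _).
rewrite /protocol_IC.
have -> : 4 * #|X|%:R * #|Y|%:R * hhat s = #|J|%:R * hhat s + #|J|%:R * hhat s :> R.
  by rewrite !card_prod card_bool !natrM; ring.
rewrite EFinD addeACA; apply: leeD.
  apply: hX => k x x' y e; apply: mE => u slot.
  have e0 := e (true, u); have e3 := e (false, u).
  by case: slot => [|[|[|slot]]] //=; rewrite /= in e0 e3; rewrite e0.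
apply: hY => k x y y' e; apply: mE => u slot.
have e1 := e (true, u); have e2 := e (false, u).
by case: slot => [|[|[|slot]]] //=; rewrite /= in e1 e2; rewrite e2.
Qed.

End Verification.

(** * Passage to the infimum over protocols *)

Theorem mainTheorem4 (R : realType) (X Y Z : finType) (f : X -> Y -> Z)
    (mu : X * Y -> R) (mu_pmf : is_pmf mu)
    (eps : R) (eps_ge0 : 0 <= eps) (eps_le1 : eps <= 1) :
  (IC mu f 0 - (4 * #|X|%:R * #|Y|%:R * hhat (Num.sqrt eps))%:E
     <= IC mu f eps)%E.
Proof.
(* The verification argument divides by [s], so [eps = 0] is treated apart; there [hhat 0 = 0]. *)
move: eps_ge0; rewrite le_eqVlt => /predU1P[<-|eps_gt0].
  suff -> : hhat (Num.sqrt (0 : R)) = 0 by rewrite mulr0 sube0.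
  rewrite sqrtr0 /hhat min_l ?divr_ge0// /binary_entropy.
  by rewrite !(mul0r, oppr0, add0r, addr0, mul1r, log2_1).
(* A measure of total mass 1 cannot live on an empty product, which provides the default pair for
   [pair_nth]. *)
have [u0 _] : exists u0 : X * Y, True.
  case: (pickP (fun _ : X * Y => true)) => [u _|none]; first by exists u.
  by case: mu_pmf => _; rewrite big_pred0// => /esym/eqP; rewrite oner_eq0.
apply: le_ereal_inf_tmp => _ [pi [pi_f ->]].
rewrite leeBlDr//; apply: le_trans (checked_IC mu_pmf u0 eps_gt0 eps_le1 pi_f).
apply: ereal_inf_lbound; exists (checked f mu pi eps u0); split=> //.
exact: checked_performs.
Qed.
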